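(* Let $a\colon V_\infty\to(0,\infty)$ satisfy $0<a_-=\inf_{V_\infty}a\le\sup_{V_\infty}a=a_+<\infty$. Let $f\colon V\times\mathbb{R}\to\mathbb{R}$ be an $L^1$-Carathéodory function with primitive $F(\boldsymbol{x},u)=\int_0^u f(\boldsymbol{x},s)\,ds$. Assume that there exist $\alpha<a_-\lambda_1$ and $\beta\in L^1(V;\mathbb{R}_+)$ such that $F(\boldsymbol{x},u)\le\frac{\alpha}{2}|u|^2+\beta(\boldsymbol{x})$ for all $u\in\mathbb{R}$ and $\mu$-a.e. $\boldsymbol{x}\in V$. Then the problem $$-\Delta_a u(\boldsymbol{x})\ni f(\boldsymbol{x},u(\boldsymbol{x}))\ \text{ for }\boldsymbol{x}\in V\setminus V_0,\qquad u(\boldsymbol{x})=0\ \text{ for }\boldsymbol{x}\in V_0,$$ has at least one solution $u^*\in H_0^1(V)$ satisfying $$I(u^* )=\min_{u\in H_0^1(V)}I(u),\qquad\text{where } I(u)=\tfrac12\mathcal{E}_a(u)-\int_V F(\boldsymbol{x},u(\boldsymbol{x}))\,d\mu(\boldsymbol{x}).$$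
   Context: Sierpiński gasket. Let $\boldsymbol{p}_1,\boldsymbol{p}_2,\boldsymbol{p}_3$ be the vertices of an equilateral triangle in $\mathbb{R}^2$ and $\boldsymbol{F}_i(\boldsymbol{x})=\frac{\boldsymbol{x}+\boldsymbol{p}_i}{2}$, $i\in\{1,2,3\}$. $V$ is the unique nonempty compact set with $V=\boldsymbol{F}_1(V)\cup\boldsymbol{F}_2(V)\cup\boldsymbol{F}_3(V)$, $V_0=\{\boldsymbol{p}_1,\boldsymbol{p}_2,\boldsymbol{p}_3\}$, and $\mu$ is the normalized Hausdorff measure on $V$ ($\mu(V)=1$). Let $\Sigma_n=\{1,2,3\}^n$, $\Sigma_\infty=\bigcup_{n\ge1}\Sigma_n$; for $\omega=(\omega_1,\dots,\omega_n)\in\Sigma_n$ put $\boldsymbol{F}_\omega=\boldsymbol{F}_{\omega_1}\circ\cdots\circ\boldsymbol{F}_{\omega_n}$ and $\boldsymbol{p}_\omega=\boldsymbol{F}_{\omega_1\ldots\omega_{n-1}}(\boldsymbol{p}_{\omega_n})$ (so $\boldsymbol{p}_{\omega i}=\boldsymbol{F}_\omega(\boldsymbol{p}_i)$). Let $V_\infty=\{\boldsymbol{p}_\omega:\omega\in\Sigma_\infty\}$. Energy. For $u\in C(V)$, $\mathcal{E}(u)=\lim_{n\to\infty}(5/3)^n\sum_{\omega\in\Sigma_n}\sum_{1\le i<j\le3}|u(\boldsymbol{p}_{\omega i})-u(\boldsymbol{p}_{\omega j})|^2\in[0,\infty]$ (the sequence is nondecreasing). $H_0^1(V)=\{u\in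 C(V):\mathcal{E}(u)<\infty,\ u=0\text{ on }V_0\}$ is a Hilbert space with norm $\|u\|_{H_0^1}=\sqrt{\mathcal{E}(u)}$. $\lambda_1$ is the first Dirichlet eigenvalue of the Laplacian, i.e. $\lambda_1^{-1}$ is the optimal constant in $\|u\|_{L^2(V,\mu)}^2\le\lambda_1^{-1}\|u\|_{H_0^1}^2$, $u\in H_0^1(V)$. Weighted energy. For $u\in H_0^1(V)$, $\mathcal{E}_a(u)=\limsup_{n\to\infty}(5/3)^n\sum_{\omega\in\Sigma_n}\sum_{1\le i<j\le3}\frac{a(\boldsymbol{p}_{\omega i})+a(\boldsymbol{p}_{\omega j})}{2}|u(\boldsymbol{p}_{\omega i})-u(\boldsymbol{p}_{\omega j})|^2$. The (possibly multivalued) weighted Laplacian $-\Delta_a$ is the convex subdifferential of $\frac12\mathcal{E}_a$ on $H_0^1(V)$. $L^1$-Carathéodory: $f(\cdot,u)$ is measurable for every $u\in\mathbb{R}$; $f(\boldsymbol{x},\cdot)$ is continuous for $\mu$-a.e. $\boldsymbol{x}$; for every $M>0$ there is $f_M\in L^1(V;\mathbb{R}_+)$ with $|f(\boldsymbol{x},u)|\le f_M(\boldsymbol{x})$ for $\mu$-a.e. $\boldsymbol{x}$ and all $u\in[-M,M]$. Solution: $u\in H_0^1(V)$ is a solution of the problem if it is a critical point of $I=\psi+\Phi$, with $\psi=\frac12\mathcal{E}_a$ and $\Phi(u)=-\int_V F(\boldsymbol{x},u(\boldsymbol{x}))\,d\mu$, in the sense that $-\Phi'(u)\in\partial\psi(u)$,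 i.e. $\frac12\mathcal{E}_a(v)-\frac12\mathcal{E}_a(u)-\int_V f(\boldsymbol{x},u(\boldsymbol{x}))(v(\boldsymbol{x})-u(\boldsymbol{x}))\,d\mu(\boldsymbol{x})\ge0$ for all $v\in H_0^1(V)$. *)

(* Defs.v *)
From HB Require Import structures.
From mathcomp Require Import all_boot all_order all_algebra.
From mathcomp Require Import all_classical all_reals all_analysis.

Set Implicit Arguments.
Unset Strict Implicit.
Unset Printing Implicit Defensive.

Import Order.TTheory GRing.Theory Num.Theory.
Import numFieldNormedType.Exports.

Local Open Scope classical_set_scope.
Local Open Scope ring_scope.

Section Plane.
Context {R : realType}.

(* The norm that the library puts on [R * R] is the sup norm; it gives the right
   topology, but distances and diameters are taken with [edist]. *)
Definition edist (x y : R * R) : R :=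
  Num.sqrt ((x.1 - y.1) ^+ 2 + (x.2 - y.2) ^+ 2).

(* [ediam set0 = -oo], and [-oo `^ s = 0] for [s != 0]. *)
Definition ediam (A : set (R * R)) : \bar R :=
  ereal_sup [set (edist z.1 z.2)%:E | z in A `*` A].

Definition fine_cover (d : R) (A : set (R * R)) : set ((set (R * R))^nat) :=
  [set U | A `<=` \bigcup_k U k /\ forall k, (ediam (U k) <= d%:E)%E].

Definition hausdorff_pre (s d : R) (A : set (R * R)) : \bar R :=
  ereal_inf [set (\sum_(k <oo) poweR (ediam (U k)) s)%E | U in fine_cover d A].

Definition hausdorff (s : R) (A : set (R * R)) : \bar R :=
  ereal_sup [set hausdorff_pre s d A | d in [set d | 0 < d]].

Section Outer.
Local Open Scope ereal_scope.
Variable s : R.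
Hypothesis s_neq0 : s != 0%R.

Lemma ediam0 : ediam set0 = -oo.
Proof.
by rewrite /ediam set0X image_set0 ereal_sup0.
Qed.

Lemma hausdorff_pre_ge0 d A : 0 <= hausdorff_pre s d A.
Proof.
by apply: le_ereal_inf_tmp => _ [U _ <-]; apply: nneseries_ge0 => *;
  exact: poweR_ge0.
Qed.

Lemma hausdorff_pre0 d : hausdorff_pre s d set0 = 0.
Proof.
apply/eqP; rewrite eq_le hausdorff_pre_ge0 andbT.
apply: ereal_inf_lbound; exists (fun=> set0).
  by split=> // k; rewrite ediam0 leNye.
by apply: eseries0 => k _ _; rewrite ediam0 poweRNyr.
Qed.

Lemma le_hausdorff_pre d :
  {homo hausdorff_pre s d : A B / A `<=` B >-> A <= B}.
Proof.
move=> A B AB; apply: ereal_inf_le_tmp => _ [U [BU dU] <-].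
by exists U => //; split=> //; exact: subset_trans BU.
Qed.

Lemma hausdorff_pre_sigma_subadditive d : sigma_subadditive (hausdorff_pre s d).
Proof.
move=> A.
have [[i ioo]|] := pselect (exists i, hausdorff_pre s d (A i) = +oo).
  rewrite (eseries_pinfty _ _ ioo) ?leey// => n _.
  by rewrite -ltNye (lt_le_trans _ (hausdorff_pre_ge0 _ _)).
rewrite -forallNE => Aoo.
suff add2e (e : {posnum R}) : hausdorff_pre s d (\bigcup_n A n) <=
    \sum_(i <oo) hausdorff_pre s d (A i) + e%:num%:E.
  by apply/lee_addgt0Pr => _/posnumP[].
rewrite (le_trans _ (epsilon_trick _ _ _))//; last first.
  by move=> n; exact: hausdorff_pre_ge0.
pose g X := poweR (ediam X) s.
have g_ge0 X : 0 <= g X by exact: poweR_ge0.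
pose P n (B : (set (R * R))^nat) := fine_cover d (A n) B /\
  \sum_(k <oo) g (B k) <= hausdorff_pre s d (A n) + (e%:num / (2 ^ n.+1)%:R)%:E.
have [G PG] : {G : ((set (R * R))^nat)^nat & forall n, P n (G n)}.
  apply: (@choice _ _ P) => n; rewrite /P.
  have Afin : hausdorff_pre s d (A n) \is a fin_num.
    rewrite ge0_fin_numE ?hausdorff_pre_ge0// ltey.
    by apply/eqP; exact: Aoo.
  have en1 : (0 < e%:num / (2 ^ n.+1)%:R)%R by [].
  have [x [B AB <-] xS] := lb_ereal_inf_adherent en1 Afin.
  by exists B; split => //; exact/ltW.
apply: (@le_trans _ _ (\esum_(i in setT) (g \o uncurry G) i)).
  apply: ereal_inf_lbound => /=.
  have /card_esym/ppcard_eqP[f] := card_nat2.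
  exists (uncurry G \o f).
    split=> [t [i _ /(PG i).1.1[j _ Gt]]|k /=].
      by exists (f^-1%FUN (i, j)) => //=; rewrite invK ?inE.
    by case: (f k) => i j; exact: (PG i).1.2.
  rewrite -(esum_pred_image (g \o uncurry G) _ xpredT) ?[fun=> _]set_true//.
  - by rewrite image_eq.
  - by move=> n _; exact: g_ge0.
rewrite (_ : esum _ _ = \sum_(i <oo) \sum_(j <oo ) g (G i j)); last first.
  pose J : nat -> set (nat * nat) := fun i => [set (i, j) | j in setT].
  rewrite (_ : setT = \bigcup_k J k); last first.
    by rewrite predeqE => -[a b]; split => // _; exists a => //; exists b.
  rewrite esum_bigcupT /=; last 2 first.
    - apply/trivIsetP => i j _ _ ij.
      rewrite predeqE => -[n m] /=; split => //= -[] [_] _ [<-{n} _].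
      by move=> [m' _] [] /esym/eqP; rewrite (negbTE ij).
    - by move=> /= [n m].
  rewrite -(image_id [set: nat]) -fun_true esum_pred_image//; last first.
    by move=> n _; exact: esum_ge0.
  apply: eq_eseriesr => /= j _.
  rewrite -(esum_pred_image (g \o uncurry G) (pair j) predT)//=; last first.
    by move=> ? ? _ _; exact: (@can_inj _ _ _ snd).
  by congr esum; rewrite predeqE => -[a b]; split; move=> [i _ <-]; exists i.
apply: lee_lim.
- by apply: is_cvg_nneseries => n *; exact: nneseries_ge0.
- apply: is_cvg_nneseries => n *.
  by apply: adde_ge0 => //; exact: hausdorff_pre_ge0.
- by near=> n; apply: lee_sum => i _; exact: (PG i).2.
Unshelve. all: by end_near. Qed.

Lemma hausdorff_ge0 A : 0 <= hausdorff s A.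
Proof.
apply: le_ereal_sup_tmp; exists (hausdorff_pre s 1 A).
  by exists 1%R => //=; exact: ltr01.
exact: hausdorff_pre_ge0.
Qed.

Lemma hausdorff0 : hausdorff s set0 = 0.
Proof.
apply/eqP; rewrite eq_le hausdorff_ge0 andbT.
by apply: ge_ereal_sup => _ [d _ <-]; rewrite hausdorff_pre0.
Qed.

Lemma le_hausdorff : {homo hausdorff s : A B / A `<=` B >-> A <= B}.
Proof.
move=> A B AB; apply: ge_ereal_sup => _ [d d0 <-].
apply: le_ereal_sup_tmp; exists (hausdorff_pre s d B); first by exists d.
exact: le_hausdorff_pre.
Qed.

Lemma hausdorff_sigma_subadditive : sigma_subadditive (hausdorff s).
Proof.
move=> A; apply: ge_ereal_sup => _ [d d0 <-].
apply: (le_trans (hausdorff_pre_sigma_subadditive _ _)).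
apply: lee_nneseries => [n _ _|n _]; first exact: hausdorff_pre_ge0.
by apply: ereal_sup_ubound; exists d.
Qed.

End Outer.
End Plane.

Section GasketMeasure.
Context {R : realType}.

Definition gasket_dim : R := ln 3 / ln 2.

Lemma gasket_dim_neq0 : gasket_dim != 0.
Proof. by rewrite gt_eqF// divr_gt0// ln_gt0// ltr1n. Qed.

(* [A |-> H^s (A `&` V) / H^s V], as an outer measure; for the gasket [V],
   [H^s V] is positive and finite. *)
Definition normalized_hausdorff (V A : set (R * R)) : \bar R :=
  ((fine (hausdorff gasket_dim V))^-1%:E * hausdorff gasket_dim (A `&` V))%E.

Section Outer.
Variable V : set (R * R).
Local Open Scope ereal_scope.

Let c_ge0 : 0 <= (fine (hausdorff gasket_dim V))^-1%:E.
Proof. by rewrite lee_fin invr_ge0 fine_ge0// hausdorff_ge0. Qed.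

Let nh0 : normalized_hausdorff V set0 = 0.
Proof.
by rewrite /normalized_hausdorff set0I hausdorff0 ?mule0 ?gasket_dim_neq0.
Qed.

Let nh_ge0 A : 0 <= normalized_hausdorff V A.
Proof. by rewrite mule_ge0// hausdorff_ge0. Qed.

Let le_nh : {homo normalized_hausdorff V : A B / A `<=` B >-> A <= B}.
Proof.
by move=> A B AB; apply: lee_wpmul2l => //; apply: le_hausdorff; exact: setSI.
Qed.

Let nh_sigma_subadditive : sigma_subadditive (normalized_hausdorff V).
Proof.
move=> A; rewrite /normalized_hausdorff nneseriesZl//; last first.
  by move=> *; exact: hausdorff_ge0.
by apply: lee_wpmul2l => //; rewrite setI_bigcupl;
  exact: hausdorff_sigma_subadditive.
Qed.

HB.instance Definition _ := isOuterMeasure.Build R (R * R)%type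
  (normalized_hausdorff V) nh0 nh_ge0 le_nh nh_sigma_subadditive.

End Outer.

(* The plane, with the sigma-algebra of the Caratheodory-measurable sets: it
   contains the Borel sets and makes the measure below complete. *)
Definition gasket_space (V : set (R * R)) : measurableType _ :=
  caratheodory_type (normalized_hausdorff V).

Definition gasket_measure (V : set (R * R)) : set (gasket_space V) -> \bar R :=
  normalized_hausdorff V.
Arguments gasket_measure V A : clear implicits.

Section Measure.
Variable V : set (R * R).
Local Open Scope ereal_scope.

Let gm0 : gasket_measure V set0 = 0.
Proof. exact: (outer_measure0 (normalized_hausdorff V)). Qed.

Let gm_ge0 (A : set (gasket_space V)) : 0 <= gasket_measure V A.
Proof. exact: (outer_measure_ge0 (normalized_hausdorff V)). Qed.

Let gm_semi_sigma_additive : semi_sigma_additive (gasket_measure V).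
Proof.
by move=> F mF tF mUF; rewrite /gasket_measure;
  exact: (@caratheodory_measure_sigma_additive _ _ (normalized_hausdorff V)).
Qed.

HB.instance Definition _ := isMeasure.Build _ _ _ (gasket_measure V)
  gm0 gm_ge0 gm_semi_sigma_additive.

End Measure.

End GasketMeasure.

Arguments gasket_measure {R} V A.

Section Gasket.
Context {R : realType}.
Implicit Types (p : 'I_3 -> R * R) (V : set (R * R)) (u a : R * R -> R).

Definition equilateral p : Prop :=
  exists2 l : R, 0 < l & forall i j, i != j -> edist (p i) (p j) = l.

Definition contraction p (i : 'I_3) (x : R * R) : R * R :=
  ((x.1 + (p i).1) / 2, (x.2 + (p i).2) / 2).

Definition is_gasket p V : Prop :=
  [/\ V !=set0, compact V & V = \bigcup_(i : 'I_3) (contraction p i @` V)].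

Definition contraction_word p (w : seq 'I_3) (x : R * R) : R * R :=
  foldr (contraction p) x w.

(* [vertex p w i] is the point indexed by the nonempty word [rcons w i]. *)
Definition vertex p (w : seq 'I_3) (i : 'I_3) : R * R :=
  contraction_word p w (p i).

Definition vertices p : set (R * R) :=
  [set vertex p wi.1 wi.2 | wi in [set: seq 'I_3 * 'I_3]].

Definition graph_energy p u (n : nat) : R :=
  (5 / 3) ^+ n * \sum_(w : n.-tuple 'I_3) \sum_(i < 3) \sum_(j < 3 | (i < j)%N)
    `|u (vertex p w i) - u (vertex p w j)| ^+ 2.

Definition energy p u : \bar R := limn (fun n => (graph_energy p u n)%:E).

Definition weighted_graph_energy p a u (n : nat) : R :=
  (5 / 3) ^+ n * \sum_(w : n.-tuple 'I_3) \sum_(i < 3) \sum_(j < 3 | (i < j)%N)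
    (a (vertex p w i) + a (vertex p w j)) / 2 *
    `|u (vertex p w i) - u (vertex p w j)| ^+ 2.

Definition weighted_energy p a u : \bar R :=
  limn_esup (fun n => (weighted_graph_energy p a u n)%:E).

(* Functions on [V] are represented by functions on the plane; everything below
   depends only on their restrictions to [V]. *)
Definition H01 p V u : Prop :=
  [/\ {within V, continuous u}, (energy p u < +oo)%E & forall i, u (p i) = 0].

(* The infimum is the optimal constant of the Poincare inequality. *)
Definition lambda1 p V : R :=
  (inf [set C : R | 0 <= C /\ forall u, H01 p V u ->
     (\int[gasket_measure V]_(x in V) ((u x) ^+ 2)%:E <= C%:E * energy p u)%E])^-1.

Definition L1_nonneg V (g : R * R -> R) : Prop :=
  (forall x, V x -> 0 <= g x) /\ (gasket_measure V).-integrable V (EFin \o g).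

Definition L1_Caratheodory V (f : R * R -> R -> R) : Prop :=
  [/\ forall t : R, measurable_fun (V : set (gasket_space V)) (f ^~ t),
      {ae gasket_measure V, forall x, V x -> continuous (f x)}
    & forall M : R, 0 < M -> exists2 fM, L1_nonneg V fM &
        {ae gasket_measure V, forall x, V x ->
          forall t, - M <= t <= M -> `|f x t| <= fM x}].

Definition primitive (f : R * R -> R -> R) (x : R * R) (t : R) : R :=
  if 0 <= t then \int[lebesgue_measure]_(r in `[0, t]) f x r
  else - \int[lebesgue_measure]_(r in `[t, 0]) f x r.

Definition functional p V a f u : \bar R :=
  ((2^-1)%:E * weighted_energy p a u
   - \int[gasket_measure V]_(x in V) (primitive f x (u x))%:E)%E.

(* The functional [w |-> \int f(x, u x) w x dmu] belongs to the convex
   subdifferential at [u] of half the weighted energy on [H01]. *)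
Definition is_solution p V a (f : R * R -> R -> R) u : Prop :=
  H01 p V u /\ forall v, H01 p V v ->
    (0 <= (2^-1)%:E * weighted_energy p a v - (2^-1)%:E * weighted_energy p a u
          - \int[gasket_measure V]_(x in V) (f x (u x) * (v x - u x))%:E)%E.

End Gasket.

(* Main.v *)
Require Import Defs.
From HB Require Import structures.
From mathcomp Require Import all_boot all_order all_algebra.
From mathcomp Require Import all_classical all_reals all_analysis.
From mathcomp Require Import ring lra measurable_realfun.
Set Implicit Arguments.
Unset Strict Implicit.
Unset Printing Implicit Defensive.
Import Order.TTheory GRing.Theory Num.Theory.
Import numFieldNormedType.Exports.
Local Open Scope classical_set_scope.
Local Open Scope ring_scope.

(** The direct method of the calculus of variations.  Since [a] lies between its
    infimum [am > 0] and its supremum [ap], the weighted energy is comparable to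
    the energy, and [alpha < am * lambda1] together with the Poincare inequality
    makes [I] coercive on [H01] ([J_coercive]).  Three facts then carry the proof.

    - Compactness ([energy_compact]).  Passing from a cell of level [n] to a
      subcell changes the value at a vertex by at most [(3/5)^(n/2)] times the
      root of the energy, because the two vertices share a cell of the next
      level.  Summing this geometric series bounds the oscillation of a function
      on a cell ([cell_oscillation]), hence its sup norm.  A sequence of bounded
      energy has a pointwise cluster point by Tychonoff's theorem, and testing at
      the finitely many vertices of one level makes the approximation uniform.

    - Lower semicontinuity ([weighted_energy_lsc]).  The weighted energy is an
      upper limit of quadratic forms and need not be a supremum, so pointwise
      convergence alone is of no use.  It is convex and continuous for the energy
      norm, however, and a uniform limit of bounded energy can be approximated in
      energy without raising the weighted energy ([energy_close_in_sublevel]):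
      among the functions that are uniformly close to the limit and have small
      weighted energy, those of nearly least energy form a Cauchy family by the
      parallelogram law.

    - Continuity of the lower order term ([cvg_integral_primitive]), which is
      dominated convergence.  It requires [x |-> F x (u x)] to be measurable.
      Continuous functions are measurable because the Hausdorff measure is a
      metric outer measure, so that closed sets satisfy Caratheodory's condition
      ([metric_outer_measure_closed]); Caratheodory functions are handled by
      discretizing [u], and the primitive by the Fubini-Tonelli theorem.

    So a minimizing sequence has a subsequence converging uniformly to a
    minimizer ([J_minimizer]).  Comparing the minimizer [u] with
    [u + t (v - u)], dividing by [t] and letting [t] tend to [0] gives the
    variational inequality, by convexity of the weighted energy
    ([minimizer_is_solution]). *)

Local Notation contraction := Defs.contraction.
Local Notation edist := Defs.edist.

(** * Graph energies *)

Section GraphEnergies.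
Context {R : realType}.
Variable p : 'I_3 -> R * R.
Implicit Types (u v a b : R * R -> R) (n : nat).

Lemma vertices_vertex w i : vertices p (vertex p w i).
Proof. by exists (w, i). Qed.

Lemma graph_energyE u n : graph_energy p u n = weighted_graph_energy p (cst 1) u n.
Proof.
congr (_ * _); apply: eq_bigr => w _; apply: eq_bigr => i _.
by apply: eq_bigr => j _; rewrite /cst -(natrD _ 1 1) divff ?mul1r ?pnatr_eq0.
Qed.

(** A graph energy is a sum of squared increments with nonnegative coefficients, so
    a quadratic inequality between increments is inherited by the energies.  Three
    terms on the right, of any sign, leave room for the parallelogram law. *)
Lemma weighted_graph_energy_combine a u v z (g : R * R -> R) (s t r : R) n :
    (forall x, vertices p x -> 0 <= a x) ->
    (forall x y, vertices p x -> vertices p y ->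
      `|g x - g y| ^+ 2 <= s * `|u x - u y| ^+ 2 + t * `|v x - v y| ^+ 2
                           + r * `|z x - z y| ^+ 2) ->
  weighted_graph_energy p a g n <= s * weighted_graph_energy p a u n
    + t * weighted_graph_energy p a v n + r * weighted_graph_energy p a z n.
Proof.
move=> a0 H; rewrite /weighted_graph_energy !(mulrCA _ ((5 / 3) ^+ n)) -!mulrDr.
rewrite ler_wpM2l ?exprn_ge0 ?divr_ge0 ?ler0n//.
rewrite !mulr_sumr -!big_split/=; apply: ler_sum => w _.
rewrite !mulr_sumr -!big_split/=; apply: ler_sum => i _.
rewrite !mulr_sumr -!big_split/=; apply: ler_sum => j _.
rewrite !(mulrCA _ ((_ + _) / 2)) -!mulrDr ler_wpM2l//.
  by rewrite divr_ge0// addr_ge0// a0//; exact: vertices_vertex.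
by apply: H; exact: vertices_vertex.
Qed.

Lemma le_weighted_graph_energy a b u n :
    (forall x, vertices p x -> a x <= b x) ->
  weighted_graph_energy p a u n <= weighted_graph_energy p b u n.
Proof.
move=> ab; rewrite ler_wpM2l ?exprn_ge0 ?divr_ge0 ?ler0n//.
do 3![apply: ler_sum => ? _]; rewrite ler_wpM2r ?exprn_ge0//.
by rewrite ler_wpM2r ?invr_ge0// lerD// ab//; exact: vertices_vertex.
Qed.

Lemma weighted_graph_energy_cst (c : R) u n :
  weighted_graph_energy p (cst c) u n = c * graph_energy p u n.
Proof.
rewrite mulrCA; congr (_ * _); rewrite mulr_sumr; apply: eq_bigr => w _.
rewrite mulr_sumr; apply: eq_bigr => i _.
by rewrite mulr_sumr; apply: eq_bigr => j _; rewrite /cst; field.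
Qed.

Lemma weighted_graph_energy_ge0 a u n :
  (forall x, vertices p x -> 0 <= a x) -> 0 <= weighted_graph_energy p a u n.
Proof.
move=> a0; apply: le_trans (le_weighted_graph_energy (a := cst 0) u n a0).
by rewrite weighted_graph_energy_cst mul0r.
Qed.

Lemma graph_energy_ge0 u n : 0 <= graph_energy p u n.
Proof. by rewrite graph_energyE weighted_graph_energy_ge0// => x _; exact: ler01. Qed.

(** Words are split at their first letter: the three first-level cells carry scaled
    copies of the level-[n] graph, which reduces statements on consecutive levels
    to the levels 0 and 1. *)
Lemma graph_energyS u n :
  graph_energy p u n.+1 = 5 / 3 * \sum_(k < 3) graph_energy p (u \o contraction p k) n.
Proof.
rewrite /graph_energy exprS -mulrA; congr (_ * _); rewrite -mulr_sumr; congr (_ * _).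
rewrite [RHS]pair_bigA/=.
rewrite (reindex (fun kw : 'I_3 * n.-tuple 'I_3 => [tuple of kw.1 :: kw.2]))/=; last first.
  exists (fun t => (thead t, [tuple of behead t])).
    by move=> [k w] _; congr pair; exact: val_inj.
  by move=> t _; rewrite [RHS]tuple_eta.
by apply: eq_bigr => -[k w] _.
Qed.

Lemma contraction_sym i j : contraction p i (p j) = contraction p j (p i).
Proof. by rewrite /contraction !(addrC (_ (p j))). Qed.

Lemma contraction_fix i : contraction p i (p i) = p i.
Proof. by rewrite /contraction; case: (p i) => x y /=; congr pair; lra. Qed.

(** For given values at the corners, the energy of level 1 is least when the midpoint
    values are those of the harmonic extension (the 2/5-2/5-1/5 rule), and the
    factor 5/3 makes this least value equal to the energy of level 0. *)
Lemma le_graph_energyS u n : graph_energy p u n <= graph_energy p u n.+1.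
Proof.
elim: n u => [|n IH] u; last first.
  by rewrite !graph_energyS ler_wpM2l ?divr_ge0 ?ler0n// ler_sum.
rewrite graph_energyS.
have sum3 (F : 'I_3 -> R) : \sum_i F i = F 0 + F 1 + F 2.
  by rewrite !big_ord_recl big_ord0 addr0 addrA; congr (F _ + F _ + F _); exact: val_inj.
have G0 v : graph_energy p v 0 = (v (p 0) - v (p 1)) ^+ 2 + (v (p 0) - v (p 2)) ^+ 2
    + (v (p 1) - v (p 2)) ^+ 2.
  rewrite /graph_energy expr0 mul1r (big_pred1 [tuple])//; last first.
    by move=> t; apply/esym/eqP; exact: tuple0.
  rewrite /vertex/= sum3 !(big_mkcond (fun j : 'I_3 => (_ < j)%N)) !sum3/=.
  by rewrite !real_normK ?num_real//; ring.
rewrite sum3 !G0/= !contraction_fix (contraction_sym 1 0) (contraction_sym 2 0)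
  (contraction_sym 2 1).
set x := u (p 0); set y := u (p 1); set z := u (p 2).
set xy := u (contraction p 0 _); set xz := u (contraction p 0 _).
set yz := u (contraction p 1 _).
(* [e], [f], [g] are the deviations from the harmonic extension: in these
   variables the difference of the two energies is a sum of squares *)
pose h s t r : R := (2 * s + 2 * t + r) / 5.
pose e := xy - h x y z; pose f := xz - h x z y; pose g := yz - h y z x.
have -> : xy = e + h x y z by rewrite subrK.
have -> : xz = f + h x z y by rewrite subrK.
have -> : yz = g + h y z x by rewrite subrK.
rewrite -subr_ge0.
set d := (X in 0 <= X).
have -> : d = 5 / 3 * ((e - f) ^+ 2 + (e - g) ^+ 2 + (f - g) ^+ 2
    + 2 * e ^+ 2 + 2 * f ^+ 2 + 2 * g ^+ 2).
  by rewrite /d /h; field.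
have := (sqr_ge0 (e - f), sqr_ge0 (e - g), sqr_ge0 (f - g), sqr_ge0 e, sqr_ge0 f, sqr_ge0 g).
case=> [] [] [] [] []; lra.
Qed.

Lemma graph_energy_nd u : nondecreasing_seq (graph_energy p u).
Proof. exact/nondecreasing_seqP/le_graph_energyS. Qed.

Lemma edge_le_graph_energy u (w : seq 'I_3) i j :
  (5 / 3) ^+ size w * (u (vertex p w i) - u (vertex p w j)) ^+ 2
    <= graph_energy p u (size w).
Proof.
wlog lij : i j / (i < j)%N => [H|].
  case: (ltngtP i j) => [/H//|/H|/val_inj ->]; first by rewrite -sqrrN opprB.
  by rewrite subrr expr0n mulr0 graph_energy_ge0.
rewrite ler_wpM2l ?exprn_ge0 ?divr_ge0 ?ler0n//.
rewrite (bigD1 (in_tuple w))//= (bigD1 i)//= (bigD1 j)//=.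
rewrite real_normK ?num_real// -!addrA lerDl !addr_ge0//.
- by apply: sumr_ge0 => *; rewrite exprn_ge0.
- by do 2![apply: sumr_ge0 => * ]; rewrite exprn_ge0.
- by do 3![apply: sumr_ge0 => * ]; rewrite exprn_ge0.
Qed.

End GraphEnergies.

(** * Energies as limits *)

Section Energies.
Context {R : realType}.
Variable p : 'I_3 -> R * R.
Implicit Types (u v a b : R * R -> R) (n : nat).

Lemma energyE u : energy p u = ereal_sup (range (fun n => (graph_energy p u n)%:E)).
Proof.
apply/cvg_lim => //; apply: ereal_nondecreasing_cvgn => m n mn.
by rewrite lee_fin graph_energy_nd.
Qed.

Lemma energy_leP u (M : \bar R) :
  (energy p u <= M)%E <-> forall n, ((graph_energy p u n)%:E <= M)%E.
Proof.
rewrite energyE; split=> [H n|H].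
  by apply: le_trans H; apply: ereal_sup_ubound; exists n.
by apply: ge_ereal_sup => _ [n _ <-].
Qed.

Lemma graph_energy_le u n : ((graph_energy p u n)%:E <= energy p u)%E.
Proof. exact/(energy_leP u _).1. Qed.

Lemma energy_ge0 u : (0 <= energy p u)%E.
Proof. by apply: le_trans (graph_energy_le u 0); rewrite lee_fin graph_energy_ge0. Qed.

Lemma energy_fin u : (energy p u < +oo)%E -> energy p u \is a fin_num.
Proof. by rewrite ge0_fin_numE// energy_ge0. Qed.

(** Reduces inequalities on upper limits in the extended reals to eventual
    inequalities between real numbers. *)
Lemma weighted_energy_leP a u (L : R) : (weighted_energy p a u <= L%:E)%E <->
  forall e, 0 < e -> \forall n \near \oo, weighted_graph_energy p a u n <= L + e.
Proof.
split=> [H e e0|H].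
  have : (weighted_energy p a u < (L + e)%:E)%E.
    by apply: le_lt_trans H _; rewrite lte_fin ltrDl.
  move=> /ereal_inf_lt[_ [A ooA <-] Ae]; apply: filterS ooA => n An.
  rewrite -lee_fin; apply/ltW/le_lt_trans/Ae.
  by apply: ereal_sup_ubound; exists n.
apply/lee_addgt0Pr => e e0; apply: ge_ereal_inf.
exists (ereal_sup ((fun n => (weighted_graph_energy p a u n)%:E) @`
  [set n | weighted_graph_energy p a u n <= L + e])); last first.
  by apply: ge_ereal_sup => _ [n /= Hn <-]; rewrite lee_fin.
by eexists; first exact: (H _ e0).
Qed.

Variables (a : R * R -> R) (am ap : R).
Hypothesis am_gt0 : 0 < am.
Hypothesis a_bnd : forall x, vertices p x -> am <= a x <= ap.

Lemma weight_ge0 x : vertices p x -> 0 <= a x.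
Proof. by move=> /a_bnd/andP[+ _]; apply: le_trans; exact: ltW. Qed.

Let a_ge0 := weight_ge0.

Lemma ap_gt0 : 0 < ap.
Proof.
have /a_bnd/andP[h1 h2] : vertices p (vertex p [::] 0) by exact: vertices_vertex.
exact: lt_le_trans am_gt0 (le_trans h1 h2).
Qed.

Lemma weighted_graph_energy_ler u n :
  weighted_graph_energy p a u n <= ap * graph_energy p u n.
Proof.
rewrite -weighted_graph_energy_cst; apply: le_weighted_graph_energy => x /a_bnd.
by case/andP.
Qed.

Lemma weighted_graph_energy_ger u n :
  am * graph_energy p u n <= weighted_graph_energy p a u n.
Proof.
rewrite -weighted_graph_energy_cst; apply: le_weighted_graph_energy => x /a_bnd.
by case/andP.
Qed.

Lemma weighted_energy_le_energy u (M : R) : (energy p u <= M%:E)%E ->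
  (weighted_energy p a u <= (ap * M)%:E)%E.
Proof.
move=> /energy_leP uM; apply/weighted_energy_leP => e e0; apply: nearW => n.
apply: le_trans (weighted_graph_energy_ler u n) _.
rewrite -[leLHS]addr0 lerD ?(ltW e0)// ler_wpM2l ?(ltW ap_gt0)//.
by have := uM n; rewrite lee_fin.
Qed.

(** Monotonicity of the graph energies matters here: an eventual bound on the
    weighted sums bounds the graph energies of all levels. *)
Lemma energy_le_weighted_energy u (L : R) : (weighted_energy p a u <= L%:E)%E ->
  (energy p u <= (L / am)%:E)%E.
Proof.
move=> /weighted_energy_leP uL; apply/energy_leP => n.
rewrite lee_fin ler_pdivlMr// mulrC; apply/ler_addgt0Pr => e e0.
have [N _ /(_ (maxn n N)) HN] := uL _ e0.
apply: le_trans (HN (leq_maxr _ _)).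
apply: le_trans (weighted_graph_energy_ger u _).
by rewrite ler_pM2l// graph_energy_nd// leq_maxl.
Qed.

Lemma weighted_energy_ge0 u : (0 <= weighted_energy p a u)%E.
Proof.
rewrite leNgt; apply/negP => u0.
suff [r r0 ur] : exists2 r : R, r < 0 & (weighted_energy p a u <= r%:E)%E.
  have := le_trans (graph_energy_le u 0) (energy_le_weighted_energy ur).
  rewrite lee_fin ler_pdivlMr// leNgt => /negP; apply.
  by rewrite (lt_le_trans r0)// mulr_ge0 ?graph_energy_ge0// ltW.
case: (weighted_energy p a u) u0 => [r| |] //; last by exists (-1); rewrite ?leNye// ltrN10.
by rewrite lte_fin => r0; exists r.
Qed.

Lemma weighted_energy_fin u : (energy p u < +oo)%E ->
  weighted_energy p a u \is a fin_num.
Proof.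
move=> /energy_fin/fineK Eu; rewrite ge0_fin_numE ?weighted_energy_ge0//.
apply: (@le_lt_trans _ _ (ap * fine (energy p u))%:E); last by rewrite ltry.
by apply: weighted_energy_le_energy; rewrite Eu.
Qed.

(** The source of convexity and of continuity in the energy norm: both are quadratic
    inequalities between increments. *)
Lemma weighted_energy_combine u v (g : R * R -> R) (s t L L' : R) :
    0 <= s -> 0 <= t ->
    (forall x y, `|g x - g y| ^+ 2 <= s * `|u x - u y| ^+ 2 + t * `|v x - v y| ^+ 2) ->
    (weighted_energy p a u <= L%:E)%E -> (weighted_energy p a v <= L'%:E)%E ->
  (weighted_energy p a g <= (s * L + t * L')%:E)%E.
Proof.
move=> s0 t0 H /weighted_energy_leP uL /weighted_energy_leP vL.
apply/weighted_energy_leP => e e0.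
pose d := e / (s + t + 1).
have st : 0 < s + t + 1 by rewrite ltr_wpDl// addr_ge0.
have d0 : 0 < d by rewrite divr_gt0.
have dst : (s + t) * d <= e.
  by rewrite /d mulrCA ler_piMr ?(ltW e0)// ler_pdivrMr// mul1r lerDl.
near=> n.
have un : weighted_graph_energy p a u n <= L + d by near: n; exact: uL.
have vn : weighted_graph_energy p a v n <= L' + d by near: n; exact: vL.
apply: (@le_trans _ _ (s * weighted_graph_energy p a u n +
    t * weighted_graph_energy p a v n + 0 * weighted_graph_energy p a u n)).
  apply: weighted_graph_energy_combine; first exact: a_ge0.
  by move=> x y _ _; rewrite mul0r addr0.
rewrite mul0r addr0.
apply: le_trans (lerD (ler_wpM2l s0 un) (ler_wpM2l t0 vn)) _.
rewrite !mulrDr; move: dst; lra.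
Unshelve. all: by end_near. Qed.

(** The energy has constant weight, so results on weighted energies apply to it. *)
Lemma energy_weighted u : energy p u = weighted_energy p (cst 1) u.
Proof.
rewrite /energy /weighted_energy is_cvg_limn_esupE.
  by congr (limn _); apply/funext => n; rewrite graph_energyE.
under eq_fun do rewrite -graph_energyE.
by apply: ereal_nondecreasing_is_cvgn => m n mn; rewrite lee_fin graph_energy_nd.
Qed.

End Energies.

(** * Lower semicontinuity of the weighted energy *)

Section LowerSemicontinuity.
Context {R : realType}.
Variable p : 'I_3 -> R * R.
Implicit Types (u v : R * R -> R) (n : nat).

(** Replaces the triangle inequality for the root of the weighted energy. *)
Lemma sqr_norm_add_young (s t e : R) : 0 < e ->
  `|s + t| ^+ 2 <= (1 + e) * `|s| ^+ 2 + (1 + e^-1) * `|t| ^+ 2.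
Proof.
move=> e0; rewrite !real_normK ?num_real// -subr_ge0.
have -> : (1 + e) * s ^+ 2 + (1 + e^-1) * t ^+ 2 - (s + t) ^+ 2 = e * (s - t / e) ^+ 2.
  by field; rewrite gt_eqF.
by rewrite mulr_ge0 ?sqr_ge0// ltW.
Qed.

(** On one level there are finitely many edges, hence the level-[n] graph energy is
    continuous for uniform convergence; [K] depends on [n]. *)
Lemma graph_energy_le_sup_norm n : exists2 K : R, 0 < K & forall (g : R * R -> R) c,
  (forall x, vertices p x -> `|g x| <= c) -> graph_energy p g n <= K * c ^+ 2.
Proof.
exists ((5 / 3) ^+ n * (\sum_(w : n.-tuple 'I_3) \sum_(i < 3) \sum_(j < 3 | (i < j)%N) 4 + 1)).
  rewrite mulr_gt0// ?exprn_gt0 ?divr_gt0 ?ltr0n// ltr_wpDl//.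
  by do 3![apply: sumr_ge0 => ? _].
move=> g c gc; rewrite -mulrA ler_wpM2l ?exprn_ge0 ?divr_ge0 ?ler0n//.
rewrite mulrDl mul1r -[leLHS]addr0 lerD ?sqr_ge0// mulr_suml; apply: ler_sum => w _.
rewrite mulr_suml; apply: ler_sum => i _; rewrite mulr_suml; apply: ler_sum => j _.
have [h1 h2] := (gc _ (vertices_vertex p w i), gc _ (vertices_vertex p w j)).
have c0 : 0 <= c by apply: le_trans h1; exact: normr_ge0.
rewrite (_ : 4 * c ^+ 2 = (c + c) ^+ 2); last by ring.
rewrite lerXn2r ?nnegrE ?addr_ge0//.
by apply: le_trans (ler_normB _ _) _; rewrite lerD.
Qed.

Variables (a : R * R -> R) (am ap : R).
Hypothesis am_gt0 : 0 < am.
Hypothesis a_bnd : forall x, vertices p x -> am <= a x <= ap.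

(** A substitute for Mazur's lemma.  Let [S d] be the set of functions [d]-close to
    [u] with weighted energy at most [L + d]; these sets are convex and shrink
    with [d].  Their least energies increase to a finite limit [sup T] as [d]
    tends to 0, so two nearly minimal elements have a midpoint of nearly the same
    energy, and the parallelogram law bounds the energy of their difference.
    Sending one of them to [u], level by level, bounds the distance of the other
    one from [u]. *)
Lemma energy_close_in_sublevel u (M L : R) :
    (forall e, 0 < e -> exists v, [/\ (energy p v <= M%:E)%E,
      (weighted_energy p a v <= (L + e)%:E)%E
      & forall x, vertices p x -> `|v x - u x| <= e]) ->
  forall e, 0 < e -> exists v, [/\ (weighted_energy p a v <= (L + e)%:E)%E
    & forall n, graph_energy p (fun x => u x - v x) n <= e].
Proof.
move=> H e e0.
pose S d v := (weighted_energy p a v <= (L + d)%:E)%E /\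
  forall x, vertices p x -> `|v x - u x| <= d.
have SS d d' v : d <= d' -> S d v -> S d' v.
  move=> dd [v1 v2]; split.
    by apply: le_trans v1 _; rewrite lee_fin lerD2l.
  by move=> x /v2 /le_trans; apply.
pose T := [set t | exists2 d, 0 < d & forall v, S d v -> exists n, t <= graph_energy p v n].
have supT : has_sup T.
  split; first by exists 0, 1 => // v _; exists 0; exact: graph_energy_ge0.
  exists M => t [d d0 dt]; have [v [vM vL vu]] := H _ d0.
  have [//|n tn] := dt v; apply: le_trans tn _.
  by have := (energy_leP p v M%:E).1 vM n; rewrite lee_fin.
(* [17 = 2 * 8 + 2 * (1 / 2)], the constants of [diff] and [small] below *)
pose h := e / 17.
have h0 : 0 < h by rewrite divr_gt0.
(* elements of [S d0] have energy above [sup T - h] *)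
have [t [d0 d00 Hd0] tD] := sup_adherent h0 supT.
have near_inf d : 0 < d -> exists v, S d v /\ forall n, graph_energy p v n < sup T + h.
  move=> dp; apply: contrapT => nv; suff : T (sup T + h).
    by move=> /(ub_le_sup supT.2); rewrite gerDl leNgt h0.
  exists d => // v Sv; apply: contrapT => nn; apply: nv; exists v; split=> // n.
  by rewrite ltNge; apply/negP => tn; apply: nn; exists n.
pose d1 := Order.min d0 e.
have d10 : 0 < d1 by rewrite lt_min d00.
have [v0 [Sv0 v0h]] := near_inf _ d10.
exists v0; split; first by apply: le_trans Sv0.1 _; rewrite lee_fin lerD2l ge_min lexx orbT.
move=> n.
have [K K0 HK] := graph_energy_le_sup_norm n.
pose d2 := Order.min d1 (Order.min 1 (h / (2 * K))).
have d20 : 0 < d2 by rewrite lt_min d10 lt_min ltr01 divr_gt0// mulr_gt0.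
have [v [Sv vh]] := near_inf _ d20.
have Sv1 : S d1 v by apply: SS Sv; rewrite ge_min lexx.
(* the midpoint stays in [S d0], whence the lower bound on its energy *)
pose mid := fun x => (v0 x + v x) / 2.
have Smid : S d0 mid.
  apply: (@SS d1); first by rewrite ge_min lexx.
  split.
    have -> : L + d1 = 2^-1 * (L + d1) + 2^-1 * (L + d1) by field.
    apply: (weighted_energy_combine am_gt0 a_bnd _ _ _ Sv0.1 Sv1.1); rewrite ?invr_ge0//.
    move=> x y; rewrite !real_normK ?num_real// -subr_ge0 /mid.
    set z := (X in 0 <= X).
    have -> : z = ((v0 x - v0 y - (v x - v y)) / 2) ^+ 2 by rewrite /z; field.
    exact: sqr_ge0.
  move=> x px; have := Sv0.2 x px; have := Sv1.2 x px; rewrite /mid !ler_norml; lra.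
have [N tN] := Hd0 _ Smid.
have diff : graph_energy p (fun x => v x - v0 x) n <= 8 * h.
  apply: le_trans (graph_energy_nd p _ (leq_maxl n N)) _; set m := maxn n N.
  (* parallelogram law *)
  apply: (@le_trans _ _ (2 * graph_energy p v m + 2 * graph_energy p v0 m +
                         (- 4) * graph_energy p mid m)).
    rewrite !graph_energyE; apply: weighted_graph_energy_combine => // x y _ _.
    rewrite !real_normK ?num_real// -subr_ge0 /mid; set z := (X in 0 <= X).
    by have -> : z = 0 by rewrite /z; field.
  have := graph_energy_nd p mid (leq_maxr n N); rewrite -/m.
  have := (vh m, v0h m); move=> [? ?]; lra.
have small : graph_energy p (fun x => u x - v x) n <= h / 2.
  apply: (le_trans (HK _ d2 _)).
    by move=> x /(Sv.2); rewrite distrC.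
  have d2h : d2 <= h / (2 * K) by rewrite !ge_min lexx !orbT.
  have d21 : d2 <= 1 by rewrite !ge_min lexx !orbT.
  apply: (@le_trans _ _ (K * d2)).
    by rewrite ler_wpM2l ?(ltW K0)// expr2 ler_piMr// ltW.
  apply: le_trans (ler_wpM2l (ltW K0) d2h) _; rewrite le_eqVlt; apply/orP; left.
  by apply/eqP; field; rewrite gt_eqF.
apply: (@le_trans _ _ (2 * graph_energy p (fun x => u x - v x) n +
   2 * graph_energy p (fun x => v x - v0 x) n + 0 * graph_energy p u n)).
  rewrite !graph_energyE; apply: weighted_graph_energy_combine => // x y _ _.
  rewrite !real_normK ?num_real// -subr_ge0; set z := (X in 0 <= X).
  have -> : z = ((u x - u y) + (v0 x - v0 y) - 2 * (v x - v y)) ^+ 2 by rewrite /z; ring.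
  exact: sqr_ge0.
rewrite mul0r addr0; have -> : e = 17 * h by rewrite /h; field.
lra.
Qed.

(** Follows from [energy_close_in_sublevel], the weighted energy being continuous for
    the energy norm. *)
Lemma weighted_energy_lsc u (M L : R) :
    (forall e, 0 < e -> exists v, [/\ (energy p v <= M%:E)%E,
      (weighted_energy p a v <= (L + e)%:E)%E
      & forall x, vertices p x -> `|v x - u x| <= e]) ->
  (weighted_energy p a u <= L%:E)%E.
Proof.
move=> /energy_close_in_sublevel H; apply/lee_addgt0Pr => e e0.
(* [d] is the parameter of Young's inequality: the error terms are [d * (L + h)],
   small by the choice of [d], and [h * K], small by that of [h] *)
pose d := Order.min 1 (e / (2 * (`|L| + 2))).
have L2 : 0 < 2 * (`|L| + 2) by rewrite mulr_gt0// ltr_wpDl.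
have d0 : 0 < d by rewrite lt_min ltr01 divr_gt0.
pose K := 1 + (1 + d^-1) * ap + 1.
have ap0 := ap_gt0 am_gt0 a_bnd.
have K0 : 0 < K by rewrite !addr_gt0// mulr_gt0// addr_gt0// invr_gt0.
pose h := Order.min 1 (e / (2 * K)).
have h0 : 0 < h by rewrite lt_min ltr01 divr_gt0// mulr_gt0.
have [v [vL uv]] := H _ h0.
have Euv : (energy p (fun x => u x - v x)%R <= h%:E)%E.
  by apply/energy_leP => n; rewrite lee_fin.
have := weighted_energy_le_energy am_gt0 a_bnd Euv => Auv.
apply: (@le_trans _ _ ((1 + d) * (L + h) + (1 + d^-1) * (ap * h))%:E).
  apply: (weighted_energy_combine am_gt0 a_bnd _ _ _ vL Auv).
  - by rewrite addr_ge0// ltW.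
  - by rewrite addr_ge0// invr_ge0 ltW.
  - move=> x y; have := sqr_norm_add_young (v x - v y) (u x - v x - (u y - v y)) d0.
    by rewrite (_ : v x - v y + _ = u x - u y)//; ring.
rewrite lee_fin.
have hK : h * K <= e / 2.
  have : h <= e / (2 * K) by rewrite ge_min lexx orbT.
  move=> /(ler_wpM2r (ltW K0)) /le_trans; apply.
  by rewrite le_eqVlt; apply/orP; left; apply/eqP; field; rewrite gt_eqF.
have dL : d * (`|L| + 2) <= e / 2.
  have : d <= e / (2 * (`|L| + 2)) by rewrite ge_min lexx orbT.
  have L3 : 0 < `|L| + 2 by rewrite ltr_wpDl.
  move=> /(ler_wpM2r (ltW L3)) /le_trans; apply.
  by rewrite le_eqVlt; apply/orP; left; apply/eqP; field; rewrite gt_eqF.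
have h1 : h <= 1 by rewrite ge_min lexx.
have dLh : d * (L + h) <= d * (`|L| + 2).
  by rewrite ler_wpM2l ?(ltW d0)//; have := ler_norm L; lra.
move: hK dL dLh h0; rewrite /K; move: (d^-1) => di; nra.
Qed.

End LowerSemicontinuity.

(** * Cells, oscillation and compactness *)

Section Cells.
Context {R : realType}.
Variables (p : 'I_3 -> R * R) (V : set (R * R)).
Hypothesis gV : is_gasket p V.
Implicit Types (u v : R * R -> R) (w : seq 'I_3).

Lemma gasket_closed : closed V.
Proof. by case: gV => _ cV _; apply: compact_closed => //; exact: norm_hausdorff. Qed.

Lemma contraction_gasket i x : V x -> V (contraction p i x).
Proof. by case: gV => _ _ VE Vx; rewrite VE; exists i => //; exists x. Qed.

Lemma contraction_word_gasket w x : V x -> V (contraction_word p w x).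
Proof. by move=> Vx; elim: w => //= i w IH; exact: contraction_gasket. Qed.

Lemma contraction_word_cat w w' x :
  contraction_word p (w ++ w') x = contraction_word p w (contraction_word p w' x).
Proof. exact: foldr_cat. Qed.

(** Iterates the self-similarity of [V]: at each level, the cells cover [V]. *)
Lemma gasket_cell n x : V x ->
  exists w : n.-tuple 'I_3, exists2 y, V y & x = contraction_word p w y.
Proof.
elim: n x => [|n IH] x Vx; first by exists [tuple], x.
case: gV => _ _ VE; move: Vx; rewrite {1}VE => -[i _ [y Vy <-]].
have [w [z Vz ->]] := IH _ Vy.
by exists [tuple of i :: w], z.
Qed.

Lemma contraction_dist i x y : `|contraction p i x - contraction p i y| = 2^-1 * `|x - y|.
Proof.
rewrite (_ : _ - _ = 2^-1 *: (x - y)); first by rewrite normrZ ger0_norm.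
by case: x y => x1 x2 [y1 y2]; congr pair => /=; rewrite /GRing.scale/=; field.
Qed.

Lemma contraction_word_dist w x y :
  `|contraction_word p w x - contraction_word p w y| = 2^-1 ^+ size w * `|x - y|.
Proof.
elim: w => [|i w IH]/=; first by rewrite mul1r.
by rewrite contraction_dist IH mulrA -exprS.
Qed.

Lemma gasket_diameter : exists2 B : R, 0 < B & forall x y, V x -> V y -> `|x - y| <= B.
Proof.
case: gV => _ /compact_bounded[B [_ VB]] _.
have h x : V x -> `|x| <= `|B| + 1.
  by move=> Vx; apply: VB => //; rewrite (le_lt_trans (ler_norm _))// ltrDl.
exists (`|B| + 1 + (`|B| + 1)); first by rewrite addr_gt0// ltr_wpDl.
by move=> x y Vx Vy; rewrite (le_trans (ler_normB _ _))// lerD// h.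
Qed.

Lemma geometric_small (q B e : R) : 0 <= q < 1 -> 0 < e -> exists n, q ^+ n * B < e.
Proof.
move=> /andP[q0 q1] e0; have : (fun n => q ^+ n * B) @ \oo --> (0 * B : R).
  by apply: cvgM; [apply: cvg_expr; rewrite ger0_norm|exact: cvg_cst].
rewrite mul0r => /cvgr0Pnorm_lt/(_ _ e0)[N _ /(_ N (leqnn N))] H; exists N.
by apply: le_lt_trans H; exact: ler_norm.
Qed.

Let half_itv : 0 <= (2^-1 : R) < 1.
Proof. by rewrite invr_ge0 ler0n invf_lt1// ltr1n. Qed.

(** [p i] is the limit of the iterates of [contraction p i] from any point of [V]. *)
Lemma fixpoint_gasket i : V (p i).
Proof.
have [[x0 Vx0] _ _] := gV; apply: gasket_closed => A /nbhs_ballP[e /= e0 Ae].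
pose B := `|p i - x0| + 1.
have [n nB] := geometric_small B half_itv e0.
exists (contraction_word p (nseq n i) x0); split.
  exact: contraction_word_gasket.
have fixi m : contraction_word p (nseq m i) (p i) = p i.
  by elim: m => //= m ->; exact: contraction_fix.
apply: Ae; rewrite -ball_normE/= -[X in X - _](fixi n) contraction_word_dist size_nseq.
by apply: le_lt_trans nB; rewrite ler_wpM2l ?exprn_ge0 ?invr_ge0// lerDl.
Qed.

Lemma vertex_gasket w i : V (vertex p w i).
Proof. by apply: contraction_word_gasket; exact: fixpoint_gasket. Qed.

Lemma vertex_fix w i : vertex p (rcons w i) i = vertex p w i.
Proof. by rewrite /vertex -cats1 contraction_word_cat/= contraction_fix. Qed.

Lemma vertex_sym w i j : vertex p (rcons w i) j = vertex p (rcons w j) i.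
Proof. by rewrite /vertex -!cats1 !contraction_word_cat/= contraction_sym. Qed.

(** By [vertex_fix] and [vertex_sym], corner 0 of the cell [w] and corner 0 of its
    subcell [w i] are the corners 0 and [i] of the subcell [w 0], hence joined by
    an edge of the next level.  The exact ratio is the root of 3/5; 4/5 is a
    rational upper bound, and [48 / 75 = (4 / 5) ^ 2]. *)
Lemma vertex_step u (s : R) w i : 0 <= s -> (energy p u <= (s ^+ 2)%:E)%E ->
  `|u (vertex p (rcons w i) 0) - u (vertex p w 0)| <= (4 / 5) ^+ (size w).+1 * s.
Proof.
move=> s0 /energy_leP Eu; rewrite -(vertex_fix w 0) vertex_sym.
have := Eu (size (rcons w 0)); rewrite lee_fin.
move=> /(le_trans (edge_le_graph_energy p u (rcons w 0) i 0)).
rewrite size_rcons => H.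
rewrite -ler_sqr ?nnegrE ?mulr_ge0 ?exprn_ge0 ?divr_ge0//.
rewrite real_normK ?num_real// exprMn.
have -> : (4 / 5 : R) ^+ (size w).+1 ^+ 2 = (48 / 75) ^+ (size w).+1.
  by rewrite exprAC; congr (_ ^+ _); field.
have h : ((5 / 3 : R) ^+ (size w).+1 * (3 / 5) ^+ (size w).+1 = 1).
  by rewrite -exprMn (_ : 5 / 3 * (3 / 5) = 1) ?expr1n//; field.
have h' : (3 / 5 : R) ^+ (size w).+1 <= (48 / 75) ^+ (size w).+1.
  by rewrite lerXn2r ?nnegrE ?divr_ge0//; lra.
apply: le_trans (ler_wpM2r (sqr_ge0 _) h').
apply: le_trans (ler_wpM2l _ H); last by rewrite exprn_ge0// divr_ge0.
by rewrite mulrA [X in X * _]mulrC h mul1r.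
Qed.

(** Sums the geometric series of the steps: 4 is [(4/5) / (1 - 4/5)]. *)
Lemma vertex_path u (s : R) w w' : 0 <= s -> (energy p u <= (s ^+ 2)%:E)%E ->
  `|u (vertex p (w ++ w') 0) - u (vertex p w 0)| <= 4 * (4 / 5) ^+ size w * s.
Proof.
move=> s0 Eu; elim: w' w => [|i w' IH] w.
  by rewrite cats0 subrr normr0 !mulr_ge0 ?exprn_ge0 ?divr_ge0.
rewrite -cat_rcons.
have := IH (rcons w i); have := vertex_step w i s0 Eu; rewrite size_rcons exprS => h1 h2.
rewrite -(subrKA (u (vertex p (rcons w i) 0))).
apply: le_trans (ler_normD _ _) _; move: h1 h2; lra.
Qed.

Lemma within_continuousP u : {within V, continuous u} <->
  forall x e, V x -> 0 < e ->
    exists2 d, 0 < d & forall y, V y -> `|x - y| < d -> `|u x - u y| < e.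
Proof.
split=> [/subspace_continuousP cu x e Vx e0|H].
  have /cvgrPdist_lt/(_ _ e0) := cu _ Vx.
  rewrite near_withinE => /nbhs_ballP[d /= d0 Hd]; exists d => // y Vy xy.
  by apply: Hd => //; rewrite -ball_normE.
apply/subspace_continuousP => x Vx; apply/cvgrPdist_lt => e e0.
have [d d0 Hd] := H _ _ Vx e0.
rewrite near_withinE; apply/nbhs_ballP; exists d => // y /= + Vy.
by rewrite -ball_normE; exact: Hd.
Qed.

(** A point of the cell [w] is a limit of corners of nested subcells, to which
    [vertex_path] applies uniformly. *)
Lemma cell_oscillation u (s : R) w x : {within V, continuous u} -> 0 <= s ->
    (energy p u <= (s ^+ 2)%:E)%E -> V x ->
  `|u (contraction_word p w x) - u (vertex p w 0)| <= 4 * (4 / 5) ^+ size w * s.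
Proof.
move=> /within_continuousP cu s0 Eu Vx; apply/ler_addgt0Pr => e e0.
have Vz := contraction_word_gasket w Vx; set z := contraction_word p w x in Vz *.
have [B B0 HB] := gasket_diameter.
have [d d0 Hd] := cu _ _ Vz e0.
have [n nB] := geometric_small B half_itv d0.
have [w' [y Vy xE]] := gasket_cell n Vx.
have := vertex_path w w' s0 Eu.
have : `|u z - u (vertex p (w ++ w') 0)| < e.
  apply: Hd; first exact: vertex_gasket.
  rewrite /z xE -contraction_word_cat contraction_word_dist size_cat size_tuple.
  apply: le_lt_trans nB; rewrite exprD -mulrA.
  apply: (@le_trans _ _ (2^-1 ^+ n * `|y - p 0|)).
    rewrite ler_piMl ?mulr_ge0 ?exprn_ge0 ?invr_ge0//.
    by rewrite exprn_ile1 ?invr_ge0// invf_le1// ler1n.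
  by rewrite ler_wpM2l ?exprn_ge0 ?invr_ge0// HB//; exact: fixpoint_gasket.
rewrite -[X in _ -> _ -> `|X| <= _](subrKA (u (vertex p (w ++ w') 0))) => h1 h2.
by rewrite addrC; apply: le_trans (ler_normD _ _) _; rewrite lerD// ltW.
Qed.

Lemma sup_norm_energy u (s : R) x : {within V, continuous u} -> 0 <= s ->
    (energy p u <= (s ^+ 2)%:E)%E -> u (p 0) = 0 -> V x ->
  `|u x| <= 4 * s.
Proof.
move=> cu s0 Eu u0 Vx; have := cell_oscillation [::] cu s0 Eu Vx.
by rewrite /vertex/= u0 subr0 expr0 mulr1.
Qed.

Lemma within_continuous_uniform u :
    (forall e, 0 < e -> exists2 v, {within V, continuous v} &
      forall x, V x -> `|v x - u x| <= e) ->
  {within V, continuous u}.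
Proof.
move=> H; apply/within_continuousP => x e Vx e0.
have e4 : 0 < e / 4 by rewrite divr_gt0.
have [v /within_continuousP/(_ _ _ Vx e4)[d d0 Hd] vu] := H _ e4.
exists d => // y Vy xy.
have := Hd _ Vy xy; have := vu _ Vx; have := vu _ Vy.
rewrite !ltr_norml !ler_norml; lra.
Qed.

(** The cluster point [g] given by Tychonoff's theorem is approximated only at
    finitely many points at a time.  The corners of the cells of one level suffice:
    all [v n] oscillate little on these cells, and so does [g], since it is
    approximated at any two points simultaneously. *)
Lemma energy_compact (v : (R * R -> R)^nat) (s : R) : 0 <= s ->
    (forall n, [/\ {within V, continuous (v n)}, (energy p (v n) <= (s ^+ 2)%:E)%E
       & v n (p 0) = 0]) ->
  exists u : R * R -> R, forall e N, 0 < e -> exists2 n, (N <= n)%N &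
    forall x, V x -> `|v n x - u x| <= e.
Proof.
move=> s0 Hv.
(* functions matter on [V] only; extending by 0 keeps them in a product of segments *)
pose v' n : prod_topology (fun _ : R * R => R) := fun x => if x \in V then v n x else 0.
pose box := [set f : prod_topology (fun _ : R * R => R) |
  forall x, `[- (4 * s), 4 * s]%classic (f x)].
have cbox : compact box.
  by apply: (tychonoff (A := fun _ => `[- (4 * s), 4 * s]%classic)) => _; exact: segment_compact.
have vbox : (v' @ \oo) box.
  exists 0 => // n _ x /=; rewrite in_itv/= -ler_norml /v'.
  case: ifPn => [/set_mem Vx|_]; last by rewrite normr0 mulr_ge0.
  by have [cv Ev v0] := Hv n; exact: sup_norm_energy.
have [g [_ cg]] := cbox (v' @ \oo) _ vbox.
pose PT : topologicalType := prod_topology (fun _ : R * R => R).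
have near_g e (s' : seq (R * R)) : 0 < e ->
    nbhs (g : PT) [set h : PT | forall x, x \in s' -> `|h x - g x| < e].
  move=> e0; elim: s' => [|x s' IH]; first exact: (@filterE PT (nbhs (g : PT))).
  have cx : nbhs (g : PT) ((fun h => h x) @^-1` ball (g x) e).
    exact: (@proj_continuous _ (fun _ : R * R => R) x g _ (nbhsx_ballx _ _ e0)).
  have hI := @filterI PT (nbhs (g : PT)) (nbhs_filter (g : PT)) _ _ cx IH.
  apply: (@filterS PT (nbhs (g : PT)) _ _ _ _ hI) => h [h1 h2] y.
  rewrite inE => /orP[/eqP ->|]; last exact: h2.
  by move: h1; rewrite /preimage/= -ball_normE/= distrC.
have close e N (s' : seq (R * R)) : 0 < e -> (forall x, x \in s' -> V x) ->
    exists2 n, (N <= n)%N & forall x, x \in s' -> `|v n x - g x| < e.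
  move=> e0 sV.
  have vN : (v' @ \oo) (v' @` [set n | (N <= n)%N]) by exists N => // n /= Nn; exists n.
  have [_ [[n /= Nn <-] Hn]] := cg _ _ vN (near_g e s' e0).
  exists n => // x xs.
  by have := Hn x xs; rewrite /v' mem_set//; exact: sV.
exists g => e N e0.
have [m Hm] : exists m, 8 * (4 / 5) ^+ m * s <= e / 2.
  have q01 : 0 <= (4 / 5 : R) < 1 by rewrite divr_ge0//=; lra.
  have [m Hm] := geometric_small (16 * s) q01 e0.
  by exists m; move: Hm; set r := (_ ^+ m); lra.
pose net := [seq vertex p w 0 | w : m.-tuple 'I_3].
have netV x : x \in net -> V x.
  by move=> /mapP[w _ ->]; exact: vertex_gasket.
have e4 : 0 < e / 6 by rewrite divr_gt0.
have [n Nn Hn] := close _ N _ e4 netV; exists n => // x Vx.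
have [w [y Vy xE]] := gasket_cell m Vx.
have wnet : vertex p w 0 \in net by apply: map_f; rewrite mem_enum.
have Vw := vertex_gasket w 0.
have [|n' _ Hn'] := close (e / 6) 0 [:: x; vertex p w 0] e4.
  by move=> z; rewrite !inE => /orP[]/eqP->.
have osc k : `|v k x - v k (vertex p w 0)| <= e / 4.
  have [cv Ev v0] := Hv k.
  have := cell_oscillation w cv s0 Ev Vy; rewrite -xE size_tuple.
  move: Hm; set r := (_ ^+ m); lra.
have := Hn _ wnet; have := osc n; have := osc n'.
have := Hn' x (mem_head _ _).
have := Hn' (vertex p w 0); rewrite inE mem_head orbT => /(_ isT).
(* from [v n x] to [g x] through the corner of the cell: [v n] at the corner, then
   [g], then [v n'] there, and [v n' x] *)
rewrite !ltr_norml !ler_norml.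
do 5![move=> /andP[? ?]]; apply/andP; split; lra.
Qed.

End Cells.

(** * Closed sets and metric outer measures *)

Section MetricOuterMeasure.
Context {R : realType} {M : normedModType R}.
Variable mu : {outer_measure set M -> \bar R}.

Definition separated_by (d : R) (A B : set M) :=
  forall x y, A x -> B y -> d <= `|x - y|.

Hypothesis metric_mu : forall d A B, 0 < d -> separated_by d A B ->
  (mu A + mu B <= mu (A `|` B))%E.

(** The sets are split off one by one, [A k] being [d k]-separated from the union of
    the later ones. *)
Lemma outer_measure_sum_separated (A : (set M)^nat) (d : R^nat) n :
    (forall k, 0 < d k) ->
    (forall k m, (k < m)%N -> separated_by (d k) (A k) (A m)) ->
  (\sum_(k < n) mu (A k) <= mu (\bigcup_k A k))%E.
Proof.
move=> d0 sepA; pose U m := \bigcup_(k in [set k | (m <= k < n)%N]) A k.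
suff H m : (\sum_(m <= k < n) mu (A k) <= mu (U m))%E.
  rewrite -(big_mkord xpredT (fun k => mu (A k))).
  apply: (le_trans (H 0)); apply: le_outer_measure.
  by apply: bigcup_subset.
have [nm|mn] := leqP n m; first by rewrite big_geq// outer_measure_ge0.
rewrite -(subKn (ltnW mn)); move: (n - m)%N (leq_subr m n) => j.
elim: j => [|j IH] jn; first by rewrite subn0 big_geq// outer_measure_ge0.
have jn' : (n - j.+1 < n)%N by rewrite ltn_subrL; case: (n) jn.
rewrite big_ltn// -subSn//= subSS.
apply: le_trans (leeD2l _ (IH (ltnW jn))) _.
apply: le_trans (metric_mu (d0 (n - j.+1)%N) _) _.
  move=> x y Ax [k /= /andP[jk kn] Ay]; apply: sepA Ax Ay.
  by rewrite (leq_trans _ jk)// -subSn.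
apply: le_outer_measure => x [Ax|[k /= /andP[jk kn] Ax]].
  by exists (n - j.+1)%N => //=; rewrite leqnn jn'.
by exists k => //=; rewrite kn andbT (leq_trans _ jk)// leq_sub2l.
Qed.

(** Caratheodory's criterion.  The part of [X] at distance at least [1 / (n + 1)]
    from [C] is [A n]; it is separated from [C], so it suffices that [mu (A n)]
    approximates [mu (X `\` C)].  The shells [S n] between consecutive [A n] are
    separated from each other when their indices differ by at least 2; hence the
    even and the odd shells have total measure at most [mu X], and the tail of the
    series of shells tends to 0. *)
Lemma metric_outer_measure_closed (C : set M) : closed C ->
  caratheodory_measurable mu C.
Proof.
move=> cC; apply: le_caratheodory_measurable => X.
have [->|Xoo] := eqVneq (mu X) +oo%E; first by rewrite leey.
have Xfin : mu X \is a fin_num by rewrite ge0_fin_numE ?outer_measure_ge0// ltey.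
pose A n := [set x | X x /\ forall c, C c -> n.+1%:R^-1 <= `|x - c|].
pose S n := A n.+1 `\` A n.
have SX n : S n `<=` X by move=> x [[]].
have invlt k m : (k < m)%N -> (m.+1%:R^-1 : R) < k.+1%:R^-1.
  by move=> km; rewrite ltf_pV2 ?posrE// ltr_nat.
have invle k m : (k <= m)%N -> (m.+1%:R^-1 : R) <= k.+1%:R^-1.
  by move=> km; rewrite lef_pV2 ?posrE// ler_nat.
have sepS k m : (k.+1 < m)%N ->
    separated_by (k.+2%:R^-1 - k.+3%:R^-1) (S k) (S m).
  move=> km x y [[Xx Ax] _] [[Xy Ay] nAy].
  have [c [Cc yc]] : exists c, C c /\ `|y - c| < m.+1%:R^-1.
    apply: contrapT => H; apply: nAy; split => // c Cc; rewrite leNgt.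
    by apply/negP => yc; apply: H; exists c.
  have := Ax c Cc; have := ler_normD (x - y) (y - c); rewrite subrKA.
  have := invle _ _ km; move: yc.
  move: (k.+2%:R^-1) (k.+3%:R^-1) (m.+1%:R^-1) => i j l; lra.
have half (h : nat -> nat) n : (forall k, (h k).+1 < h k.+1)%N ->
    (\sum_(k < n) mu (S (h k)) <= mu X)%E.
  move=> hh.
  have hm k m : (k < m)%N -> ((h k).+1 < h m)%N.
    elim: m => // m IH; rewrite ltnS leq_eqVlt => /orP[/eqP ->//|/IH].
    by move=> /ltn_trans; apply; apply: (ltn_trans _ (hh m)).
  apply: le_trans (@outer_measure_sum_separated (fun k => S (h k)) (fun k => (h k).+2%:R^-1 - (h k).+3%:R^-1) n _ _) _.
  - by move=> k; rewrite subr_gt0 invlt.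
  - by move=> k m km; apply: sepS; exact: hm.
  - by apply: le_outer_measure => x [k _ /SX].
have sumS n : (\sum_(k < n) mu (S k) <= mu X + mu X)%E.
  apply: (@le_trans _ _ (\sum_(k < n) (mu (S k.*2) + mu (S k.*2.+1)))%E).
    apply: (@le_trans _ _ (\sum_(k < n.*2) mu (S k))%E).
      rewrite -!(big_mkord xpredT (fun k => mu (S k))).
      apply: lee_sum_nneg_natr => //; last by rewrite -addnn leq_addr.
    rewrite le_eqVlt; apply/orP; left; apply/eqP.
    elim: n => [|n IH]; first by rewrite !big_ord0.
    by rewrite doubleS !big_ord_recr/= IH addeA.
  by rewrite big_split/=; apply: leeD;
    [apply: (half double)|apply: (half (fun k => k.*2.+1))] => k; rewrite doubleS.
have cvS : (\sum_(k <oo) mu (S k) < +oo)%E.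
  apply: (@le_lt_trans _ _ (mu X + mu X)%E).
    apply: lime_le; first by apply: is_cvg_nneseries => *; exact: outer_measure_ge0.
    by apply: nearW => n; rewrite big_mkord.
  by rewrite -ge0_fin_numE ?adde_ge0 ?outer_measure_ge0// fin_numD Xfin.
have tail := nneseries_tail_cvg cvS (fun k _ => outer_measure_ge0 mu (S k)).
have XC n : (mu (X `&` ~` C) <= mu (A n) + \sum_(n <= k <oo) mu (S k))%E.
  pose F k := if (k < n)%N then set0 else S k.
  apply: (@le_trans _ _ (mu (A n `|` \bigcup_k F k))).
    apply: le_outer_measure => x [Xx nCx].
    have [r r0 rC] : exists2 r : R, 0 < r & forall c, C c -> r <= `|x - c|.
      have : nbhs x (~` C) by apply: open_nbhs_nbhs; split=> //; exact: closed_openC.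
      move=> /nbhs_ballP[r /= r0 rC]; exists r => // c Cc.
      rewrite leNgt; apply/negP => xc; apply: (rC c) => //.
      by rewrite -ball_normE.
    have [m Am] : exists m, A m x.
      exists (Num.truncn r^-1); split => // c Cc; apply: le_trans (rC _ Cc).
      rewrite -[leRHS]invrK lef_pV2 ?posrE ?invr_gt0//.
      by rewrite ltW// truncnS_gt.
    have [nm|mn] := leqP m n.
      left; split => // c Cc; apply: le_trans (Am.2 _ Cc); exact: invle.
    have [An|nAn] := pselect (A n x); [by left|right].
    pose P k := `[< A k x >] && (n <= k)%N.
    have exP : exists k, P k by exists m; rewrite /P (ltnW mn) andbT; exact/asboolP.
    case: (ex_minnP exP) => k /andP[/asboolP Ak nk] kmin.
    case: k => [|k] in Ak nk kmin *.
      by move: nk; rewrite leqn0 => /eqP n0; rewrite n0 in nAn.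
    have nk' : (n <= k)%N.
      by move: nk; rewrite leq_eqVlt => /orP[/eqP nk|//]; rewrite nk in nAn.
    exists k => //; rewrite /F ltnNge nk'/=; split=> // Ak'.
    by have := kmin k; rewrite /P nk' andbT ltnn => H; have := H (asboolT Ak').
  apply: (le_trans (outer_measureU2 _ _ _)); rewrite leeD2l//.
  apply: (le_trans (outer_measure_sigma_subadditive mu F)).
  rewrite le_eqVlt; apply/orP; left; apply/eqP; congr (limn _).
  apply/funext => m; rewrite (big_nat_widenl n 0)// [RHS]big_mkcond/=.
  apply: eq_bigr => k _; rewrite /F.
  by case: ltnP => //= _; rewrite outer_measure0.
have key n : (mu (X `&` C) + mu (X `&` ~` C) <= mu X + \sum_(n <= k <oo) mu (S k))%E.
  apply: le_trans (leeD2l _ (XC n)) _; rewrite addeA leeD2r//.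
  apply: le_trans (metric_mu (d := n.+1%:R^-1) _ _) _.
  - by rewrite invr_gt0.
  - by move=> x y [_ Cx] [_ /(_ _ Cx)]; rewrite distrC.
  - by apply: le_outer_measure => x [[]//|[]].
have cv : (fun n => mu X + \sum_(n <= k <oo) mu (S k))%E @ \oo --> (mu X + 0)%E.
  by apply: cvgeD => //; [rewrite fin_num_adde_defl|exact: cvg_cst].
rewrite -[leRHS]adde0; apply: (cvge_to_ge cv).
exact: nearW.
Qed.

End MetricOuterMeasure.

(** * Measurability on the gasket *)

Section HausdorffMetric.
Context {R : realType}.
Local Open Scope ereal_scope.
Variable s : R.
Hypothesis s_neq0 : s != 0%R.

(** Lets separation be measured by the norm of the plane, while diameters are
    Euclidean. *)
Lemma norm_le_edist (x y : R * R) : (`|x - y| <= edist x y)%R.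
Proof.
rewrite prod_normE/= ge_max /edist -!sqrtr_sqr !ler_sqrt ?addr_ge0 ?sqr_ge0//.
by rewrite lerDl lerDr !sqr_ge0.
Qed.

Lemma hausdorff_pre_anti (d d' : R) A : (d <= d')%R ->
  hausdorff_pre s d' A <= hausdorff_pre s d A.
Proof.
move=> dd'; apply: ereal_inf_le_tmp => _ [U [AU dU] <-]; exists U => //.
by split=> // k; apply: le_trans (dU k) _; rewrite lee_fin.
Qed.

Lemma ediam_meet_separated (d d' : R) (A B U : set (R * R)) :
    (d' < d)%R -> separated_by d A B -> ediam U <= d'%:E ->
  U `&` A !=set0 -> U `&` B !=set0 -> False.
Proof.
move=> dd sAB Ud [x [Ux Ax]] [y [Uy By]].
have : (edist x y)%:E <= ediam U by apply: ereal_sup_ubound; exists (x, y).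
move=> /le_trans/(_ Ud); rewrite lee_fin => /(le_trans (norm_le_edist _ _)).
by rewrite leNgt (lt_le_trans dd)//; exact: sAB.
Qed.

(** No set of diameter less than [d] meets both [A] and [B], so a fine cover of the
    union splits into a cover of [A] and a cover of [B]; the sets left out are
    replaced by [set0], whose contribution is [(-oo) `^ s = 0]. *)
Lemma hausdorff_pre_separated (d d' : R) A B :
    (d' < d)%R -> separated_by d A B ->
  hausdorff_pre s d' A + hausdorff_pre s d' B <= hausdorff_pre s d' (A `|` B).
Proof.
move=> dd sAB; apply: le_ereal_inf_tmp => _ [U [ABU dU] <-].
pose part C k := if pselect (U k `&` C !=set0) then U k else set0.
have part_cover C : C `<=` A `|` B -> fine_cover d' C (part C).
  move=> CAB; split=> [x Cx|k].
    have [k _ Ukx] := ABU _ (CAB _ Cx); exists k => //; rewrite /part.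
    by case: pselect => //= -[]; exists x.
  by rewrite /part; case: pselect => /= _; rewrite ?dU// ediam0 leNye.
apply: (@le_trans _ _ (\sum_(k <oo) poweR (ediam (part A k)) s +
    \sum_(k <oo) poweR (ediam (part B k)) s)).
  apply: leeD; apply: ereal_inf_lbound.
    by exists (part A) => //; apply: part_cover; exact: subsetUl.
  by exists (part B) => //; apply: part_cover; exact: subsetUr.
rewrite -nneseriesD; try by move=> *; exact: poweR_ge0.
apply: lee_nneseries => k _; first by rewrite adde_ge0 ?poweR_ge0.
rewrite /part; case: pselect => UA; case: pselect => UB /=;
  rewrite ?ediam0 ?poweRNyr ?adde0 ?add0e ?poweR_ge0//.
by case: (ediam_meet_separated dd sAB (dU k)).
Qed.

Lemma hausdorff_separated (d : R) A B : (0 < d)%R -> separated_by d A B ->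
  hausdorff s A + hausdorff s B <= hausdorff s (A `|` B).
Proof.
move=> d0 sAB.
have le_pre e C : (0 < e)%R -> hausdorff_pre s e C <= hausdorff s C.
  by move=> e0; apply: ereal_sup_ubound; exists e.
have fin_part e C : (0 < e)%R -> hausdorff s (A `|` B) < +oo -> C `<=` A `|` B ->
    hausdorff s C \is a fin_num /\ hausdorff_pre s e C \is a fin_num.
  move=> e0 ABoo CAB; have Coo := le_lt_trans (le_hausdorff s CAB) ABoo.
  by rewrite !ge0_fin_numE ?hausdorff_ge0 ?hausdorff_pre_ge0//; split=> //;
    exact: le_lt_trans (le_pre _ _ e0) Coo.
have [->|] := eqVneq (hausdorff s (A `|` B)) +oo; first by rewrite leey.
rewrite -ltey => ABoo.
have [Bfin _] := fin_part _ _ d0 ABoo (@subsetUr _ A B).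
rewrite -leeBrDr//; apply: ge_ereal_sup => _ [e /= e0 <-].
have [_ Afin] := fin_part _ _ e0 ABoo (@subsetUl _ A B).
rewrite leeBrDr// -leeBrDl//; apply: ge_ereal_sup => _ [e' /= e'0 <-].
rewrite leeBrDl//.
pose m := (Order.min (Order.min e e') (d / 2))%R.
have m0 : (0 < m)%R by rewrite /m !lt_min e0 e'0 divr_gt0.
have md : (m < d)%R by rewrite /m gt_min; apply/orP; right; lra.
apply: le_trans (le_pre m _ m0); apply: le_trans (hausdorff_pre_separated md sAB).
by apply: leeD; apply: hausdorff_pre_anti; rewrite /m !ge_min lexx ?orbT.
Qed.

End HausdorffMetric.

Section GasketSpace.
Context {R : realType}.
Implicit Types V : set (R * R).

(** A constant is required to carry the canonical outer measure structure. *)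
Definition hausdorff_gasket : set (R * R) -> \bar R := hausdorff gasket_dim.
HB.instance Definition _ := isOuterMeasure.Build R (R * R)%type hausdorff_gasket
  (@hausdorff0 R _ gasket_dim_neq0) (@hausdorff_ge0 R gasket_dim)
  (@le_hausdorff R gasket_dim) (@hausdorff_sigma_subadditive R gasket_dim).

(** Caratheodory's condition for the normalized measure on a set [X] is a multiple
    of the one for the Hausdorff measure on [X `&` V]. *)
Lemma gasket_space_closed V (C : set (R * R)) : closed C ->
  measurable (C : set (gasket_space V)).
Proof.
move=> cC; suff: caratheodory_measurable (normalized_hausdorff V) C by [].
move=> X; have H : caratheodory_measurable hausdorff_gasket C.
  apply: metric_outer_measure_closed => // d A B d0 sAB.
  exact: (hausdorff_separated gasket_dim_neq0 d0 sAB).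
rewrite /normalized_hausdorff (_ : hausdorff _ (X `&` V) =
    hausdorff gasket_dim (X `&` C `&` V) + hausdorff gasket_dim (X `&` ~` C `&` V))%E.
  by rewrite ge0_muleDr ?hausdorff_ge0.
by rewrite -(setIAC X V) -(setIAC X V (~` C)); exact: H.
Qed.

Lemma gasket_space_open V (U : set (R * R)) : open U ->
  measurable (U : set (gasket_space V)).
Proof.
move=> oU; rewrite -[U]setCK; apply: measurableC.
by apply: gasket_space_closed; exact: open_closedC.
Qed.

Lemma within_continuous_measurable V (u : R * R -> R) : closed V ->
  {within V, continuous u} -> measurable_fun (V : set (gasket_space V)) u.
Proof.
move=> cV /continuousP cu.
apply: (measurability _ (measurable_realfun.RGenOInfty.measurableE R)) => _ [_ [a ->] <-].
have /open_subspaceP[U oU UV] : open (u @^-1` `]a, +oo[ : set (subspace V)).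
  by apply: cu; exact: interval_open.
rewrite setIC -UV; apply: measurableI; [exact: gasket_space_open|exact: gasket_space_closed].
Qed.

End GasketSpace.

(** * Measurability of Carathéodory functions *)

Section CaratheodoryFunctions.
Context {R : realType}.

(** [u] is the pointwise limit of the step functions [r n \o u] with values in
    [1 / (n + 1)] times the integers; along such a function, [f] is countably
    piecewise one of the measurable sections [f ^~ t]. *)
Lemma measurable_comp_caratheodory d (T : measurableType d) (D : set T)
    (f : T -> R -> R) (u : T -> R) :
    measurable D -> (forall t, measurable_fun D (f ^~ t)) ->
    (forall x, D x -> continuous (f x)) -> measurable_fun D u ->
  measurable_fun D (fun x => f x (u x)).
Proof.
move=> mD mf cf mu.
pose r n (t : R) : R := (Num.floor (n.+1%:R * t))%:~R / n.+1%:R.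
apply: (@measurable_fun_cvg _ _ _ _ (fun n x => f x (r n (u x)))).
  move=> n _ B mB.
  pose I (k : int) : set R := `[k%:~R / n.+1%:R, (k + 1)%:~R / n.+1%:R[%classic.
  rewrite (_ : _ `&` _ = \bigcup_(k in [set: int])
      ((D `&` u @^-1` I k) `&` (D `&` (f ^~ (k%:~R / n.+1%:R)) @^-1` B))).
    apply: countable_bigcupT_measurable => // k; apply: measurableI.
      by apply: mu => //; exact: measurable_itv.
    exact: mf.
  apply/seteqP; split=> [x [Dx /= Bx]|x [k _ [[Dx ux] [_ Bx]]]].
    exists (Num.floor (n.+1%:R * u x)) => //; split; split=> //=.
    rewrite /I/= in_itv/= ler_pdivrMr// ltr_pdivlMr// [u x * _]mulrC.
    by rewrite floor_le/= floorD1_gt.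
  split=> //=; suff -> : r n (u x) = k%:~R / n.+1%:R by [].
  congr (_%:~R / _); apply: floor_def; move: ux.
  by rewrite /I/= in_itv/= ler_pdivrMr// ltr_pdivlMr// [u x * _]mulrC.
move=> x Dx; suff ru : r n (u x) @[n --> \oo] --> u x.
  exact: (cvg_comp _ _ ru (cf x Dx (u x))).
apply/cvgrPdist_le => e e0.
exists (Num.truncn e^-1) => // n /= en.
have n0 : 0 < n.+1%:R :> R by [].
have h1 := floor_le (n.+1%:R * u x); have h2 := floorD1_gt (n.+1%:R * u x).
have ne : n.+1%:R^-1 <= e.
  rewrite -[leRHS]invrK lef_pV2 ?posrE ?invr_gt0// ltW// (lt_le_trans (truncnS_gt _))//.
  by rewrite ler_nat.
rewrite /r; set k := Num.floor _ in h1 h2 *.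
have -> : u x - k%:~R / n.+1%:R = (n.+1%:R * u x - k%:~R) / n.+1%:R.
  by field; rewrite gt_eqF.
rewrite normrM; apply: le_trans ne; rewrite !ger0_norm ?invr_ge0// ?subr_ge0//.
rewrite ler_piMl ?invr_ge0//; move: h2; rewrite intrD; lra.
Qed.

(** [f] is jointly measurable by [measurable_comp_caratheodory] on the product space,
    applied to the second projection in place of [u].  Tonelli's theorem then
    applies to its positive and negative parts separately. *)
Lemma measurable_Rintegral_caratheodory d (T : measurableType d) (D : set T)
    (f : T -> R -> R) (i : interval R) :
    measurable D -> (forall t, measurable_fun D (f ^~ t)) ->
    (forall x, D x -> continuous (f x)) ->
  measurable_fun D (fun x => \int[lebesgue_measure]_(r in [set` i]) f x r).
Proof.
move=> mD mf cf.
have mj : measurable_fun (D `*` [set: measurableTypeR R]) (fun z => f z.1 z.2).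
  apply: (@measurable_comp_caratheodory _ _ _ (fun z t => f z.1 t) snd).
  - exact: measurableX.
  - move=> t; apply: (measurable_comp mD) (mf t) _.
      by move=> _ [[x y] [? _] <-].
    exact: measurable_funTS.
  - by move=> z [Dz _]; exact: cf.
  - exact: measurable_funTS.
have mi : measurable [set` i] by exact: measurable_itv.
have part (h : \bar R -> \bar R) : measurable_fun setT h -> (forall y, 0 <= h y)%E ->
   measurable_fun D (fun x => \int[lebesgue_measure]_(r in [set` i]) h (f x r)%:E)%E.
  move=> mh h0.
  pose g := (fun z : T * measurableTypeR R => h (f z.1 z.2)%:E) \_ (D `*` [set` i]).
  have mg : measurable_fun setT g.
    apply/(measurable_restrictT _ _).1; first exact: measurableX.
    apply: measurableT_comp => //; apply: measurableT_comp => //.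
    by apply: measurable_funS mj => //; [exact: measurableX|move=> z [? ?]].
  have g0 z : (0 <= g z)%E by rewrite /g /patch; case: ifPn.
  have := measurable_fun_fubini_tonelli_F (m2 := lebesgue_measure) g mg g0.
  move=> /(measurable_funS measurableT (@subsetT _ D)).
  apply: eq_measurable_fun => x /set_mem Dx; rewrite /fubini_F [RHS]integral_mkcond.
  apply: eq_integral => y _; rewrite /g /patch.
  case: ifPn => [/set_mem[/= _ yi]|]; first by rewrite mem_set.
  by case: ifPn => // /set_mem yi; rewrite mem_set.
have mp : measurable_fun D (fun x => \int[lebesgue_measure]_(r in [set` i])
    ((EFin \o f x)^\+ r)%E)%E.
  apply: eq_measurable_fun (part (fun y => maxe y 0%E) _ _).
  - by move=> x _; apply: eq_integral => r _; rewrite funeposE.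
  - exact: measurable_maxe.
  - by move=> y; rewrite le_max lexx orbT.
have mn : measurable_fun D (fun x => \int[lebesgue_measure]_(r in [set` i])
    ((EFin \o f x)^\- r)%E)%E.
  apply: eq_measurable_fun (part (fun y => maxe (- y)%E 0%E) _ _).
  - by move=> x _; apply: eq_integral => r _; rewrite funenegE.
  - by apply: measurable_maxe => //; exact: oppe_measurable.
  - by move=> y; rewrite le_max lexx orbT.
under eq_fun do rewrite /Rintegral integralE.
apply: measurableT_comp; first exact: fine_measurable.
exact: emeasurable_funB.
Qed.

End CaratheodoryFunctions.

(** * The primitive *)

Section Primitive.
Context {R : realType}.
Implicit Types (f : R * R -> R -> R) (x : R * R).

Lemma continuous_itv_integrable (g : R -> R) (b1 b2 : R) : continuous g ->
  lebesgue_measure.-integrable `[b1, b2] (EFin \o g).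
Proof.
move=> cg; apply: continuous_compact_integrable; first exact: segment_compact.
exact: continuous_subspaceT.
Qed.

(** A single formula for both signs of [y], to which the fundamental theorem of
    calculus applies. *)
Lemma primitiveE f x (c y : R) : continuous (f x) -> c < 0 -> c < y ->
  primitive f x y = \int[lebesgue_measure]_(r in `[c, y]) f x r
                    - \int[lebesgue_measure]_(r in `[c, 0]) f x r.
Proof.
move=> cf c0 cy; have ci := fun b1 b2 => continuous_itv_integrable b1 b2 cf.
rewrite /primitive; case: ifPn => [y0|]; last rewrite -ltNge => y0.
  rewrite Rintegral_itvB ?bnd_simp ?(ltW c0)// Rintegral_itv_obnd_cbnd//.
  by apply: integrableS (ci 0 y) => //; exact: subset_itv_oc_cc.
rewrite -[RHS]opprB; congr (- _).
rewrite Rintegral_itvB ?bnd_simp ?(ltW cy) ?(ltW y0)// Rintegral_itv_obnd_cbnd//.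
by apply: integrableS (ci y 0) => //; exact: subset_itv_oc_cc.
Qed.

Lemma is_derive_primitive f x (t : R) : continuous (f x) ->
  is_derive t 1 (primitive f x) (f x t).
Proof.
move=> cf; pose c := - (`|t| + 1).
have c0 : c < 0 by rewrite oppr_lt0 ltr_wpDl.
have ct : c < t by rewrite ltrNl (le_lt_trans (ler_norm _))// normrN ltrDl.
apply: near_eq_is_derive (_ : is_derive t 1
    ((fun y => \int[lebesgue_measure]_(r in `[c, y]) f x r)
     - cst (\int[lebesgue_measure]_(r in `[c, 0]) f x r)) (f x t)).
  by near=> y; rewrite (primitiveE cf c0)//; near: y; exact: lt_nbhsr.
have t1 : t < t + 1 by rewrite ltrDl.
have [d1 d2] := continuous_FTC1_closed t1
  (continuous_itv_integrable c (t + 1) cf) ct (cf t).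
have D1 : is_derive t 1 (fun y => \int[lebesgue_measure]_(r in `[c, y]) f x r) (f x t).
  by apply: DeriveDef; [exact: d1|rewrite -derive1E; exact: d2].
have := is_deriveB D1 (is_derive_cst (\int[lebesgue_measure]_(r in `[c, 0]) f x r) t 1).
by rewrite subr0.
Unshelve. all: by end_near. Qed.

Lemma primitive_lipschitz f x (M K s t : R) : continuous (f x) ->
    (forall r, - M <= r <= M -> `|f x r| <= K) ->
    - M <= s <= M -> - M <= t <= M ->
  `|primitive f x t - primitive f x s| <= K * `|t - s|.
Proof.
move=> cf fK.
wlog st : s t / s <= t => [H hs ht|].
  have /orP[st|ts] := le_total s t; first exact: H.
  by rewrite distrC [X in _ * X]distrC; exact: H.
move=> /andP[s1 s2] /andP[t1 t2].
have cF : {within `[s, t], continuous (primitive f x)}.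
  apply: continuous_subspaceT => r; apply: differentiable_continuous.
  by apply/derivable1_diffP; have [] := is_derive_primitive r cf.
have [r] := MVT_segment st (fun r _ => is_derive_primitive r cf) cF.
rewrite in_itv/= => /andP[sr rt] ->; rewrite normrM ler_wpM2r// fK//.
by rewrite (le_trans s1 sr) (le_trans rt t2).
Qed.

Lemma primitive0 f x : primitive f x 0 = 0.
Proof. by rewrite /primitive lexx set_itv1 Rintegral_set1. Qed.

End Primitive.

(** * Nemytskii operators on the gasket *)

Lemma difference_quotient_cvg (R : realType) (F : R -> R) (a d h : R) :
    is_derive a 1 F d ->
  n.+1%:R * (F (a + n.+1%:R^-1 * h) - F a) @[n --> \oo] --> d * h.
Proof.
move=> [dF dE]; have [->|h0] := eqVneq h 0.
  by rewrite mulr0; apply: cvg_near_cst; apply: nearW => n; rewrite mulr0 addr0 subrr mulr0.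
have cF : y^-1 * (F (y + a) - F a) @[y --> 0^'] --> d.
  rewrite -dE; apply: cvg_trans dF; apply: near_eq_cvg; apply: nearW => y.
  by rewrite /= /GRing.scale/= mulr1.
pose t n : R := n.+1%:R^-1 * h.
have t0 : t n @[n --> \oo] --> 0^'.
  have : t n @[n --> \oo] --> 0.
    by rewrite -[X in _ --> X](mul0r h); apply: cvgM; [exact: cvg_harmonic|exact: cvg_cst].
  move=> ct A A0; have : \forall n \near \oo, t n != 0 -> A (t n) := ct _ A0.
  apply: filterS => n; apply.
  by rewrite mulf_eq0 negb_or h0 invr_eq0 pnatr_eq0.
apply: cvg_trans (cvgM (cvg_comp _ _ t0 cF) (cvg_cst h)).
apply: near_eq_cvg; apply: nearW => n /=; rewrite /t (addrC _ a) invfM invrK.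
by field.
Qed.

Section Nemytskii.
Context {R : realType} (V : set (R * R)).
Hypothesis cV : closed V.
Local Notation mu := (gasket_measure V).

Lemma gasket_measurable : measurable (V : set (gasket_space V)).
Proof. exact: gasket_space_closed. Qed.

Let mV := gasket_measurable.

(** The measure is complete: every subset of a null set is measurable. *)
Lemma measurable_fun_off_null (N : set (gasket_space V)) (h : gasket_space V -> R) :
    measurable N -> mu N = 0 ->
    measurable_fun (V `\` N : set (gasket_space V)) h ->
  measurable_fun (V : set (gasket_space V)) h.
Proof.
move=> mN N0 mh _ B mB.
have VE : V `&` h @^-1` B = ((V `\` N) `&` h @^-1` B) `|` (V `&` N `&` h @^-1` B).
  apply/seteqP; split=> [x [Vx Bx]|x [[[Vx _] Bx]|[[Vx _] Bx]]] //.
  by have [Nx|Nx] := pselect (N x); [right|left].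
rewrite VE; apply: measurableU; first exact: (mh (measurableD mV mN) _ mB).
apply: (@measure_is_complete_caratheodory _ _ (normalized_hausdorff V)).
by exists N; split=> // x [[_ Nx] _].
Qed.

Variable f : R * R -> R -> R.
Hypothesis hf : L1_Caratheodory V f.

Lemma caratheodory_null_set : exists N : set (gasket_space V),
  [/\ measurable N, mu N = 0 & forall x, (V `\` N) x -> continuous (f x)].
Proof.
have [_ [N [mN N0 sub]] _] := hf; exists N; split=> // x [Vx Nx].
by apply: contrapT => nc; apply/Nx/sub => /(_ Vx).
Qed.

Lemma measurable_nemytskii (u : gasket_space V -> R) :
    measurable_fun (V : set (gasket_space V)) u ->
  measurable_fun (V : set (gasket_space V)) (fun x => f x (u x)).
Proof.
move=> mu_; have [N [mN N0 cN]] := caratheodory_null_set; have [mf _ _] := hf.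
apply: (measurable_fun_off_null mN N0).
pose D : set (gasket_space V) := V `\` N.
have DV : D `<=` V by move=> x [].
have mD : measurable D by exact: measurableD.
have muD : measurable_fun D u := measurable_funS mV DV mu_.
have mfD t : measurable_fun D (f ^~ t) := measurable_funS mV DV (mf t).
exact: (@measurable_comp_caratheodory R _ (gasket_space V) D f u mD mfD cN muD).
Qed.

Lemma measurable_primitive (u : gasket_space V -> R) :
    measurable_fun (V : set (gasket_space V)) u ->
  measurable_fun (V : set (gasket_space V)) (fun x => primitive f x (u x)).
Proof.
move=> mu_; have [N [mN N0 cN]] := caratheodory_null_set; have [mf _ _] := hf.
apply: (measurable_fun_off_null mN N0).
pose D : set (gasket_space V) := V `\` N.
have DV : D `<=` V by move=> x [].
have mD : measurable D by exact: measurableD.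
have muD : measurable_fun D u := measurable_funS mV DV mu_.
have mfD t : measurable_fun D (f ^~ t) := measurable_funS mV DV (mf t).
have mI := fun i => @measurable_Rintegral_caratheodory R _ (gasket_space V) D f i mD mfD cN.
apply: (@measurable_comp_caratheodory R _ (gasket_space V) D (primitive f) u mD _ _ muD).
  move=> t; rewrite /primitive; case: (0 <= t); first exact: mI.
  by apply: measurableT_comp (mI _).
move=> x /cN cf r; apply: differentiable_continuous; apply/derivable1_diffP.
by have [] := is_derive_primitive r cf.
Qed.

Lemma ae_caratheodory_bound (M : R) : 0 < M -> exists2 g, L1_nonneg V g &
  {ae mu, forall x, V x -> continuous (f x) /\
    forall t, - M <= t <= M -> `|f x t| <= g x}.
Proof.
move=> M0; have [_ cf /(_ _ M0)[g gL fg]] := hf; exists g => //.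
have FF := ae_filter_ringOfSetsType mu.
by apply: filterS2 cf fg => x h1 h2 Vx; split; [exact: h1|exact: h2].
Qed.

(** Dominated convergence, with dominating function [M * g] for [g] the Caratheodory
    bound of [f] on [[-M, M]]. *)
Lemma cvg_integral_primitive (w : nat -> gasket_space V -> R)
    (u : gasket_space V -> R) (M : R) : 0 < M ->
    (forall n, measurable_fun (V : set (gasket_space V)) (w n)) ->
    measurable_fun (V : set (gasket_space V)) u ->
    (forall n x, V x -> `|w n x| <= M) -> (forall x, V x -> `|u x| <= M) ->
    (forall x, V x -> w n x @[n --> \oo] --> u x) ->
  mu.-integrable V (fun x => (primitive f x (u x))%:E) /\
  (\int[mu]_(x in V) (primitive f x (w n x))%:E @[n --> \oo] -->
     \int[mu]_(x in V) (primitive f x (u x))%:E)%E.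
Proof.
move=> M0 mw mu_ wM uM wu; have [g [g0 ig] fg] := ae_caratheodory_bound M0.
have FF := ae_filter_ringOfSetsType mu.
have mF (v : gasket_space V -> R) : measurable_fun (V : set (gasket_space V)) v ->
    measurable_fun (V : set (gasket_space V)) (fun x => (primitive f x (v x))%:E).
  by move=> mv; apply/measurable_EFinP; exact: measurable_primitive.
have cF : {ae mu, forall x, V x ->
    (primitive f x (w n x))%:E @[n --> \oo] --> (primitive f x (u x))%:E}.
  apply: filterS fg => x fg Vx; have [cf _] := fg Vx.
  apply: cvg_EFin; first exact: nearW.
  apply: (cvg_comp _ _ (wu x Vx)).
  apply: differentiable_continuous; apply/derivable1_diffP.
  by have [] := is_derive_primitive (u x) cf.
have iM : mu.-integrable V (fun x => M%:E * (g x)%:E)%E by exact: integrableZl.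
have bF : {ae mu, forall x n, V x ->
    (`|(primitive f x (w n x))%:E| <= M%:E * (g x)%:E)%E}.
  apply: filterS fg => x fg n Vx; have [cf fM] := fg Vx.
  rewrite lee_fin -[primitive _ _ _]subr0 -(primitive0 f x).
  have M0M : - M <= 0 <= M by rewrite lerNl oppr0 ltW.
  have wMM : - M <= w n x <= M by rewrite -ler_norml wM.
  apply: le_trans (primitive_lipschitz cf fM M0M wMM) _.
  by rewrite subr0 mulrC ler_wpM2r ?g0// wM.
by have [iF _ ?] := dominated_convergence mV (fun n => mF _ (mw n)) (mF _ mu_) cF iM bF.
Qed.

(** The directional derivative of [u |-> \int F(x, u x)] along [h], by dominated
    convergence: the mean value theorem bounds the quotients by [M * g]. *)
Lemma cvg_integral_quotient (u h : gasket_space V -> R) (M : R) : 0 < M ->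
    measurable_fun (V : set (gasket_space V)) u ->
    measurable_fun (V : set (gasket_space V)) h ->
    (forall x, V x -> `|h x| <= M) ->
    (forall n x, V x -> `|u x + n.+1%:R^-1 * h x| <= M) -> (forall x, V x -> `|u x| <= M) ->
  mu.-integrable V (fun x => (f x (u x) * h x)%:E) /\
  (\int[mu]_(x in V) (n.+1%:R * (primitive f x (u x + n.+1%:R^-1 * h x) -
     primitive f x (u x)))%:E @[n --> \oo] -->
     \int[mu]_(x in V) (f x (u x) * h x)%:E)%E.
Proof.
move=> M0 mu_ mh hM whM uM; have [g [g0 ig] fg] := ae_caratheodory_bound M0.
have FF := ae_filter_ringOfSetsType mu.
have muh n : measurable_fun (V : set (gasket_space V)) (fun x => u x + n.+1%:R^-1 * h x).
  exact: (measurable_funD mu_ (measurable_funM (measurable_cst _) mh)).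
pose q n x := n.+1%:R * (primitive f x (u x + n.+1%:R^-1 * h x) - primitive f x (u x)).
have mq n : measurable_fun (V : set (gasket_space V)) (fun x => (q n x)%:E).
  apply/measurable_EFinP; apply: (measurable_funM (measurable_cst _)).
  exact: (measurable_funB (measurable_primitive (muh n)) (measurable_primitive mu_)).
have ml : measurable_fun (V : set (gasket_space V)) (fun x => (f x (u x) * h x)%:E).
  apply/measurable_EFinP.
  exact: (measurable_funM (measurable_nemytskii mu_) mh).
have cq : {ae mu, forall x, V x -> (q n x)%:E @[n --> \oo] --> (f x (u x) * h x)%:E}.
  apply: filterS fg => x fg Vx; have [cf _] := fg Vx.
  apply: cvg_EFin; first exact: nearW.
  exact: difference_quotient_cvg (is_derive_primitive (u x) cf).
have iM : mu.-integrable V (fun x => M%:E * (g x)%:E)%E by exact: integrableZl.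
have bq : {ae mu, forall x n, V x -> (`|(q n x)%:E| <= M%:E * (g x)%:E)%E}.
  apply: filterS fg => x fg n Vx; have [cf fM] := fg Vx.
  have n0 : 0 < n.+1%:R :> R by [].
  have uMM : - M <= u x <= M by rewrite -ler_norml uM.
  have whMM : - M <= u x + n.+1%:R^-1 * h x <= M by rewrite -ler_norml whM.
  rewrite lee_fin normrM gtr0_norm// -ler_pdivlMl//.
  apply: le_trans (primitive_lipschitz cf fM uMM whMM) _.
  rewrite addrC addKr normrM gtr0_norm ?invr_gt0// mulrCA ler_wpM2l ?invr_ge0//.
  by rewrite mulrC ler_wpM2r ?g0// hM.
by have [iq _ ?] := dominated_convergence mV mq ml cq iM bq.
Qed.

End Nemytskii.

(** * Existence of a minimizer *)

Section Existence.
Context {R : realType} (p : 'I_3 -> R * R) (V : set (R * R)).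
Hypothesis gV : is_gasket p V.
Variables (a : R * R -> R) (am ap : R).
Hypothesis am_gt0 : 0 < am.
Hypothesis a_bnd : forall x, vertices p x -> am <= a x <= ap.
Variable f : R * R -> R -> R.
Hypothesis hf : L1_Caratheodory V f.
Implicit Types u v : R * R -> R.

Local Notation mu := (gasket_measure V).
Let cV : closed V := gasket_closed gV.
Let mV := gasket_measurable cV.

Lemma H01_measurable u : H01 p V u -> measurable_fun (V : set (gasket_space V)) u.
Proof. by case=> cu _ _; exact: within_continuous_measurable. Qed.

Lemma H01_energyE u : H01 p V u -> energy p u = (fine (energy p u))%:E.
Proof. by case=> _ /energy_fin/fineK ->. Qed.

Lemma H01_bound u (S : R) x : H01 p V u -> (energy p u <= S%:E)%E -> V x ->
  `|u x| <= 4 * Num.sqrt S.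
Proof.
move=> [cu _ u0] uS Vx; apply: (sup_norm_energy gV cu (sqrtr_ge0 S) _ (u0 0) Vx).
rewrite sqr_sqrtr//.
by have := le_trans (energy_ge0 p u) uS; rewrite lee_fin.
Qed.

Lemma convex_sqr (s r t : R) : 0 <= t <= 1 ->
  `|s + t * (r - s)| ^+ 2 <= (1 - t) * `|s| ^+ 2 + t * `|r| ^+ 2.
Proof.
move=> /andP[t0 t1]; rewrite !real_normK ?num_real// -subr_ge0.
have -> : (1 - t) * s ^+ 2 + t * r ^+ 2 - (s + t * (r - s)) ^+ 2
    = t * (1 - t) * (s - r) ^+ 2 by ring.
by rewrite mulr_ge0 ?sqr_ge0// mulr_ge0// subr_ge0.
Qed.

Definition segment_point u v (t : R) := fun x => u x + t * (v x - u x).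

Lemma weighted_energy_convex (b : R * R -> R) (bm bp : R) u v (t L L' : R) :
    0 < bm -> (forall x, vertices p x -> bm <= b x <= bp) -> 0 <= t <= 1 ->
    (weighted_energy p b u <= L%:E)%E -> (weighted_energy p b v <= L'%:E)%E ->
  (weighted_energy p b (segment_point u v t) <= ((1 - t) * L + t * L')%:E)%E.
Proof.
move=> bm0 bb t01; have /andP[t0 t1] := t01.
apply: (weighted_energy_combine bm0 bb) => //; first by rewrite subr_ge0.
move=> x y; have := convex_sqr (u x - u y) (v x - v y) t01.
by rewrite (_ : segment_point u v t x - _ =
  u x - u y + t * (v x - v y - (u x - u y)))// /segment_point; ring.
Qed.

Lemma H01_segment u v (t : R) : 0 <= t <= 1 -> H01 p V u -> H01 p V v ->
  H01 p V (segment_point u v t).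
Proof.
move=> t01 Hu Hv; have [cu Eu u0] := Hu; have [cv Ev v0] := Hv.
split.
- move=> x; apply: cvgD; first exact: cu.
  by apply: cvgM; [exact: cvg_cst|apply: cvgB; [exact: cv|exact: cu]].
- apply: (@le_lt_trans _ _ ((1 - t) * fine (energy p u) + t * fine (energy p v))%:E).
    rewrite energy_weighted; apply: (weighted_energy_convex (bm := 1) (bp := 1)) => //.
    + by move=> x _; rewrite /cst lexx.
    + by rewrite -energy_weighted fineK// energy_fin.
    + by rewrite -energy_weighted fineK// energy_fin.
  exact: ltry.
- by move=> i; rewrite /segment_point u0 v0 subrr mulr0 addr0.
Qed.

Lemma H01_0 : H01 p V (cst 0).
Proof.
split=> //; first by move=> x; exact: cvg_cst.
apply: (@le_lt_trans _ _ 0%:E); last exact: ltry.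
apply/energy_leP => n; rewrite lee_fin /graph_energy big1 ?mulr0// => w _.
by rewrite big1// => i _; rewrite big1// => j _; rewrite subrr normr0 expr0n.
Qed.

Let W u := fine (weighted_energy p a u).
Let Phi u := fine (\int[mu]_(x in V) (primitive f x (u x))%:E)%E.
Let J u := 2^-1 * W u - Phi u.

Lemma WE u : H01 p V u -> weighted_energy p a u = (W u)%:E.
Proof. by case=> _ Eu _; rewrite fineK// (weighted_energy_fin am_gt0 a_bnd). Qed.

Lemma H01_primitive_integrable u : H01 p V u ->
  mu.-integrable V (fun x => (primitive f x (u x))%:E).
Proof.
move=> Hu; pose M := 4 * Num.sqrt (fine (energy p u)) + 1.
have M0 : 0 < M by rewrite ltr_wpDl// mulr_ge0// sqrtr_ge0.
have uM x : V x -> `|u x| <= M.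
  have uE : (energy p u <= (fine (energy p u))%:E)%E by rewrite -H01_energyE.
  by move=> /(H01_bound Hu uE)/le_trans; apply; rewrite /M lerDl.
have mu_ := H01_measurable Hu.
have [] := @cvg_integral_primitive R V cV f hf (fun=> u) u M M0 (fun=> mu_) mu_ (fun=> uM) uM
  (fun x _ => cvg_cst (u x)).
by [].
Qed.

Lemma PhiE u : H01 p V u ->
  (\int[mu]_(x in V) (primitive f x (u x))%:E)%E = (Phi u)%:E.
Proof.
move=> Hu; rewrite /Phi fineK//; apply: integrable_fin_num; first exact: mV.
exact: H01_primitive_integrable.
Qed.

Lemma functionalE u : H01 p V u -> functional p V a f u = (J u)%:E.
Proof. by move=> Hu; rewrite /functional WE// PhiE. Qed.

Section Coercive.
Variables (alpha : R) (beta : R * R -> R).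
Hypothesis halpha : alpha < am * lambda1 p V.
Hypothesis hbeta : L1_nonneg V beta.
Hypothesis hF : {ae mu, forall x, V x -> forall t : R,
  primitive f x t <= alpha / 2 * `|t| ^+ 2 + beta x}.

(** [lambda1] is the inverse of an infimum that is 0 by convention if no constant is
    admissible.  In that case [alpha < am * lambda1 = 0], which contradicts
    [0 < alpha]; so the set of constants is inhabited, and since the energy of [u]
    is finite its infimum is admissible too. *)
Lemma poincare u : 0 < alpha -> H01 p V u ->
  (\int[mu]_(x in V) ((u x) ^+ 2)%:E <= ((lambda1 p V)^-1 * fine (energy p u))%:E)%E.
Proof.
move=> alpha0 Hu; rewrite /lambda1 invrK; set S := [set C | _].
have e0 : 0 <= fine (energy p u) by rewrite fine_ge0// energy_ge0.
have Su C : S C -> (\int[mu]_(x in V) ((u x) ^+ 2)%:E <= (C * fine (energy p u))%:E)%E.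
  by move=> [_ /(_ _ Hu)]; rewrite {1}H01_energyE.
have [C SC] : S !=set0.
  apply/set0P/eqP => S0; have := halpha.
  by rewrite /lambda1 -/S S0 inf_out ?invr0 ?mulr0 ?ltNge ?(ltW alpha0)// => -[[]].
have q0 : (0 <= \int[mu]_(x in V) ((u x) ^+ 2)%:E)%E.
  by apply: integral_ge0 => x _; rewrite lee_fin sqr_ge0.
have qfin : (\int[mu]_(x in V) ((u x) ^+ 2)%:E)%E \is a fin_num.
  by rewrite ge0_fin_numE// (le_lt_trans (Su _ SC))// ltry.
move: Su; rewrite -(fineK qfin) => Su; rewrite lee_fin.
move: e0; rewrite le_eqVlt => /predU1P[e0|e0].
  by have := Su _ SC; rewrite -e0 !mulr0 lee_fin.
rewrite -ler_pdivrMr//; apply: lb_le_inf; first by exists C.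
by move=> D /Su; rewrite lee_fin ler_pdivrMr.
Qed.

(** The growth condition, integrated.  Replacing [alpha] by its positive part [al]
    makes the upper bound nonnegative, so that monotonicity of the integral of
    nonnegative functions applies to the positive part of [F]. *)
Lemma Phi_le_energy : exists k B, k < am / 2 /\ forall u, H01 p V u ->
  Phi u <= k * fine (energy p u) + B.
Proof.
have [beta0 ibeta] := hbeta.
pose b := fine (\int[mu]_(x in V) (beta x)%:E)%E.
have bE : (\int[mu]_(x in V) (beta x)%:E)%E = b%:E.
  by rewrite fineK//; apply: integrable_fin_num; [exact: mV|exact: ibeta].
pose al := Order.max alpha 0.
have al0 : 0 <= al by rewrite le_max lexx orbT.
have FF := ae_filter_ringOfSetsType mu.
have upper u : H01 p V u ->
    ((Phi u)%:E <= (al / 2)%:E * \int[mu]_(x in V) ((u x) ^+ 2)%:E + b%:E)%E.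
  move=> Hu; have mu_ := H01_measurable Hu.
  have msq : measurable_fun (V : set (gasket_space V)) (fun x => (u x ^+ 2)%:E).
    by apply/measurable_EFinP; exact: (measurable_funX 2 mu_).
  have msq' : measurable_fun (V : set (gasket_space V)) (fun x => ((al / 2)%:E * (u x ^+ 2)%:E)%E).
    exact: measurable_funeM.
  have mbeta : measurable_fun (V : set (gasket_space V)) (fun x => (beta x)%:E).
    by have /integrableP[] := ibeta.
  have mF : measurable_fun (V : set (gasket_space V)) (fun x => (primitive f x (u x))%:E).
    by have /integrableP[] := H01_primitive_integrable Hu.
  have al20 : (0 <= (al / 2)%:E)%E by rewrite lee_fin divr_ge0.
  have sq0 (x : gasket_space V) : V x -> (0 <= (u x ^+ 2)%:E)%E.
    by move=> _; rewrite lee_fin sqr_ge0.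
  have sq0' (x : gasket_space V) : V x -> (0 <= (al / 2)%:E * (u x ^+ 2)%:E)%E.
    by move=> Vx; rewrite mule_ge0// sq0.
  have b0 (x : gasket_space V) : V x -> (0 <= (beta x)%:E)%E.
    by move=> Vx; rewrite lee_fin beta0.
  have <- : (\int[mu]_(x in V) ((al / 2)%:E * (u x ^+ 2)%:E + (beta x)%:E) =
      (al / 2)%:E * \int[mu]_(x in V) ((u x) ^+ 2)%:E + b%:E)%E.
    by rewrite (ge0_integralD mu mV sq0' msq' b0 mbeta) (ge0_integralZl mu mV msq sq0 al20) bE.
  rewrite -PhiE// integralE.
  pose F (x : gasket_space V) := (primitive f x (u x))%:E; rewrite -/F.
  have mFp : measurable_fun (V : set (gasket_space V)) F^\+%E := measurable_funepos mF.
  apply: (@le_trans _ _ (\int[mu]_(x in V) F^\+%E x)%E).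
    rewrite geeDl// oppe_le0; apply: integral_ge0 => x _; exact: funeneg_ge0.
  have F0 (x : gasket_space V) : V x -> (0 <= F^\+%E x)%E by move=> _; exact: funepos_ge0.
  have s0 (x : gasket_space V) : V x -> (0 <= (al / 2)%:E * (u x ^+ 2)%:E + (beta x)%:E)%E.
    by move=> Vx; rewrite adde_ge0 ?sq0' ?b0.
  have ms := emeasurable_funD msq' mbeta.
  apply: (ae_ge0_le_integral mV F0 mFp s0 ms).
  apply: filterS hF => x /[swap] Vx /(_ Vx (u x)) Fx.
  rewrite funeposE ge_max (s0 _ Vx) andbT -EFinM -EFinD lee_fin.
  apply: le_trans Fx _; rewrite lerD2r real_normK ?num_real//.
  by rewrite ler_wpM2r ?sqr_ge0// ler_pM2r// le_max lexx.
case: (ltP 0 alpha) => alpha0.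
  have alE : al = alpha by apply: max_l; exact: ltW.
  have lam0 : 0 < lambda1 p V by rewrite -(pmulr_rgt0 _ am_gt0) (lt_trans alpha0).
  exists (alpha / 2 * (lambda1 p V)^-1), b; split.
    by rewrite mulrAC ltr_pM2r// ltr_pdivrMr.
  move=> u Hu; rewrite -lee_fin; apply: le_trans (upper _ Hu) _.
  rewrite EFinD leeD2r// alE -(mulrA (alpha / 2)) [leRHS]EFinM.
  apply: lee_wpmul2l; last exact: poincare.
  by rewrite lee_fin divr_ge0// ltW.
exists 0, b; split; first by rewrite divr_gt0.
move=> u Hu; rewrite -lee_fin; apply: le_trans (upper _ Hu) _.
have -> : al = 0 by apply: max_r.
by rewrite mul0r mul0e mul0r.
Qed.

Lemma J_coercive : exists c B, 0 < c /\ forall u, H01 p V u ->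
  c * fine (energy p u) <= J u + B.
Proof.
have [k [B [kam PB]]] := Phi_le_energy.
exists (am / 2 - k), B; split; first by rewrite subr_gt0.
move=> u Hu; have := PB _ Hu.
have : am * fine (energy p u) <= W u.
  have := energy_le_weighted_energy am_gt0 a_bnd (_ : weighted_energy p a u <= (W u)%:E)%E.
  by rewrite WE// lexx H01_energyE// lee_fin ler_pdivlMr// mulrC; exact.
rewrite /J; lra.
Qed.

(** The direct method: coercivity bounds the energies of a minimizing sequence,
    [energy_compact] extracts a uniformly convergent subsequence, the integral of
    [F] passes to the limit and the weighted energy is lower semicontinuous. *)
Lemma J_minimizer : exists2 u, H01 p V u & forall v, H01 p V v -> J u <= J v.
Proof.
have [c [B [c0 cB]]] := J_coercive.
pose T := [set J u | u in H01 p V].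
have J_ge u : H01 p V u -> - B <= J u.
  move=> Hu; have := cB _ Hu; have : 0 <= c * fine (energy p u).
    by rewrite mulr_ge0 ?(ltW c0)// fine_ge0// energy_ge0.
  lra.
have infT : has_inf T.
  split; first by exists (J (cst 0)), (cst 0) => //; exact: H01_0.
  by exists (- B) => _ [u Hu <-]; exact: J_ge.
have min_T u : H01 p V u -> inf T <= J u.
  by move=> Hu; apply: ge_inf; [exact: infT.2|exists u].
have /choice[v Hv] n : exists v, H01 p V v /\ J v < inf T + n.+1%:R^-1.
  have n0 : 0 < n.+1%:R^-1 :> R by rewrite invr_gt0.
  by have [_ [v Hv <-] Jv] := inf_adherent n0 infT; exists v.
pose S := (inf T + 1 + B) / c.
have vS n : (energy p (v n) <= S%:E)%E.
  have [Hvn Jvn] := Hv n; rewrite H01_energyE// lee_fin ler_pdivlMr// mulrC.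
  apply: le_trans (cB _ Hvn) _; rewrite lerD2r; apply/ltW/(lt_le_trans Jvn).
  by rewrite lerD2l invf_le1// ler1n.
have S0 : 0 <= S by have := le_trans (energy_ge0 p _) (vS 0); rewrite lee_fin.
have [u Hu] : exists u : R * R -> R, forall e N, 0 < e -> exists2 n, (N <= n)%N &
    forall x, V x -> `|v n x - u x| <= e.
  apply: (energy_compact gV (sqrtr_ge0 S)) => n; have [[cv Ev v0] _] := Hv n.
  by rewrite sqr_sqrtr//; split=> //; exact: vS.
have /choice[n Hn] k : exists n, (k <= n)%N /\
    forall x, V x -> `|v n x - u x| <= k.+1%:R^-1.
  have k0 : 0 < k.+1%:R^-1 :> R by rewrite invr_gt0.
  by have [n kn Hn] := Hu _ k k0; exists n.
pose w k := v (n k).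
have Hw k : H01 p V (w k) := (Hv (n k)).1.
have wu k x : V x -> `|w k x - u x| <= k.+1%:R^-1 by apply: (Hn k).2.
have small (e : R) : 0 < e -> \forall k \near \oo, k.+1%:R^-1 <= e.
  move=> e0; have /cvgr0Pnorm_le/(_ _ e0) := @cvg_harmonic R.
  by apply: filterS => k; apply: le_trans; exact: ler_norm.
have cw x : V x -> w k x @[k --> \oo] --> u x.
  move=> Vx; apply/cvgrPdist_le => e /small; apply: filterS => k.
  by rewrite distrC; apply: le_trans; exact: wu.
have eu : (energy p u <= S%:E)%E.
  rewrite energy_weighted; apply: (@weighted_energy_lsc R p (cst 1) 1 1 ltr01 _ u S S).
    by move=> x _; rewrite /cst lexx.
  move=> e /small[k _ /(_ k (leqnn k)) ke]; exists (w k); split; first exact: vS.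
    rewrite -energy_weighted; apply: le_trans (vS _) _.
    by rewrite lee_fin lerDl (le_trans _ ke).
  by move=> x [[wd i] _ <-]; rewrite (le_trans (wu _ _ _))//; exact: vertex_gasket.
have Hu01 : H01 p V u.
  split.
  - apply: within_continuous_uniform => e /small[k _ /(_ k (leqnn k)) ke].
    exists (w k); first by have [] := Hw k.
    by move=> x Vx; rewrite (le_trans (wu _ _ Vx)).
  - by rewrite (le_lt_trans eu)// ltry.
  - move=> i; have := cw _ (fixpoint_gasket gV i).
    have -> : (fun k => w k (p i)) = cst 0.
      by apply/funext => k; have [_ _ ->] := Hw k.
    by move/cvg_lim => <- //; rewrite lim_cst.
pose M := 4 * Num.sqrt S + 1.
have M0 : 0 < M by rewrite ltr_wpDl// mulr_ge0// sqrtr_ge0.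
have le_M g x : H01 p V g -> (energy p g <= S%:E)%E -> V x -> `|g x| <= M.
  by move=> Hg gS Vx; rewrite (le_trans (H01_bound Hg gS Vx))// /M lerDl.
have cPhi : Phi (w k) @[k --> \oo] --> Phi u.
  have [_] := @cvg_integral_primitive R V cV f hf w u M M0
    (fun k => H01_measurable (Hw k)) (H01_measurable Hu01)
    (fun k x => le_M _ _ (Hw k) (vS (n k))) (fun x => le_M _ _ Hu01 eu) cw.
  by rewrite PhiE// => /fine_cvg.
have Wu : (weighted_energy p a u <= (2 * (inf T + Phi u))%:E)%E.
  apply: (weighted_energy_lsc am_gt0 a_bnd (M := S)) => e e0.
  have e4 : 0 < e / 4 by rewrite divr_gt0.
  have nearPhi : \forall k \near \oo, `|Phi u - Phi (w k)| < e / 4.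
    by move/cvgrPdist_lt : cPhi; apply.
  have [k [ke Pk]] := filter_ex (filterI (small _ e4) nearPhi).
  have e1 : k.+1%:R^-1 <= e by move: e0 ke; set j := k.+1%:R^-1; lra.
  exists (w k); split; first exact: vS.
    rewrite WE// lee_fin.
    have [_ Jw] := Hv (n k); rewrite -/(w k) /J in Jw.
    have nk : (n k).+1%:R^-1 <= k.+1%:R^-1 :> R.
      by rewrite lef_pV2 ?posrE// ler_nat ltnS (Hn k).1.
    move: Jw nk ke Pk; rewrite ltr_norml => Jw nk ke /andP[P1 P2].
    move: Jw nk ke P1 P2.
    move: (inf T) (W (w k)) (Phi (w k)) (Phi u) (k.+1%:R^-1) ((n k).+1%:R^-1).
    move=> m' W' P' P j j'; lra.
  move=> x [[wd i] _ <-]; rewrite (le_trans (wu _ _ _))//; exact: vertex_gasket.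
exists u; first exact: Hu01.
move=> g Hg; apply: le_trans (min_T _ Hg).
move: Wu; rewrite (WE Hu01) lee_fin /J.
move: (inf T) (W u) (Phi u) => m' W' P'; lra.
Qed.

End Coercive.

(** With [t n = 1 / (n + 1)], minimality and convexity bound
    [(Phi (u + t n (v - u)) - Phi u) / t n] by half of the difference of the
    weighted energies of [v] and [u]; the limit [n --> oo] is the claim. *)
Lemma minimizer_is_solution u : H01 p V u -> (forall v, H01 p V v -> J u <= J v) ->
  is_solution p V a f u.
Proof.
move=> Hu Ju; split=> // v Hv.
have [cu Eu u0] := Hu; have [cv Ev v0] := Hv.
pose S := Order.max (fine (energy p u)) (fine (energy p v)).
have uS : (energy p u <= S%:E)%E by rewrite H01_energyE// lee_fin le_max lexx.
have vS : (energy p v <= S%:E)%E by rewrite H01_energyE// lee_fin le_max lexx orbT.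
pose M := 4 * Num.sqrt S + 4 * Num.sqrt S + 1.
have sqS : 0 <= 4 * Num.sqrt S by rewrite mulr_ge0// sqrtr_ge0.
have M0 : 0 < M by rewrite ltr_wpDl// addr_ge0.
have uB x : V x -> `|u x| <= 4 * Num.sqrt S by apply: H01_bound.
have vB x : V x -> `|v x| <= 4 * Num.sqrt S by apply: H01_bound.
pose h x := v x - u x.
pose t n : R := n.+1%:R^-1.
have t01 n : 0 <= t n <= 1 by rewrite /t invr_ge0 ler0n/= invf_le1// ler1n.
have Hs n : H01 p V (segment_point u v (t n)) by apply: H01_segment.
have hM x : V x -> `|h x| <= M.
  move=> Vx; have := uB _ Vx; have := vB _ Vx; have := ler_normB (v x) (u x).
  rewrite /h /M; lra.
have uM x : V x -> `|u x| <= M.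
  by move=> Vx; have := uB _ Vx; rewrite /M; lra.
have sM n x : V x -> `|u x + n.+1%:R^-1 * h x| <= M.
  move=> Vx; have /andP[t0 t1] := t01 n; have := uB _ Vx; have := vB _ Vx.
  rewrite -/(t n) /h !ler_norml => /andP[v1 v2] /andP[u1 u2]; rewrite /M.
  move: (4 * Num.sqrt S) sqS v1 v2 u1 u2 => s s0 v1 v2 u1 u2.
  by apply/andP; split; nra.
have mu_ := H01_measurable Hu.
have mh : measurable_fun (V : set (gasket_space V)) h.
  exact: (measurable_funB (H01_measurable Hv) mu_).
have [ifh cfh] := @cvg_integral_quotient R V cV f hf u h M M0 mu_ mh hM sM uM.
have quotE n : (\int[mu]_(x in V) (n.+1%:R * (primitive f x (u x + n.+1%:R^-1 * h x) -
     primitive f x (u x)))%:E = (n.+1%:R * (Phi (segment_point u v (t n)) - Phi u))%:E)%E.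
  have i1 := H01_primitive_integrable (Hs n); have i2 := H01_primitive_integrable Hu.
  under eq_integral do rewrite EFinM EFinB.
  rewrite (integralZl mV (integrableB mV i1 i2)) (integralB_EFin mV i1 i2).
  by rewrite !PhiE.
have bound n : n.+1%:R * (Phi (segment_point u v (t n)) - Phi u) <= 2^-1 * (W v - W u).
  have Ws : W (segment_point u v (t n)) <= (1 - t n) * W u + t n * W v.
    rewrite -lee_fin -WE//; apply: (weighted_energy_convex am_gt0 a_bnd) => //.
      by rewrite WE.
    by rewrite WE.
  rewrite -ler_pdivlMl//; have := Ju _ (Hs n); rewrite /J -/(t n).
  move: Ws; move: (W _) (Phi (segment_point u v (t n))) => Wn Pn; lra.
have fh : (\int[mu]_(x in V) (f x (u x) * h x)%:E <= (2^-1 * (W v - W u))%:E)%E.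
  apply: (cvge_to_le cfh); apply: nearW => n.
  by rewrite quotE lee_fin.
have fhfin : (\int[mu]_(x in V) (f x (u x) * h x)%:E)%E \is a fin_num.
  by apply: integrable_fin_num; [exact: mV|exact: ifh].
rewrite !WE// -(fineK fhfin) -!EFinM -!EFinB lee_fin.
move: fh; rewrite -(fineK fhfin) lee_fin; lra.
Qed.

End Existence.

Theorem theorem13 (R : realType) (p : 'I_3 -> R * R) (V : set (R * R))
    (hp : equilateral p) (hV : is_gasket p V)
    (a : R * R -> R)
    (ha_pos : forall x, vertices p x -> 0 < a x)
    (ha_inf : 0 < inf (a @` vertices p))
    (ha_sup : has_ubound (a @` vertices p))
    (f : R * R -> R -> R) (hf : L1_Caratheodory V f)
    (alpha : R) (halpha : alpha < inf (a @` vertices p) * lambda1 p V)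
    (beta : R * R -> R) (hbeta : L1_nonneg V beta)
    (hF : {ae gasket_measure V, forall x, V x -> forall t : R,
             primitive f x t <= alpha / 2 * `|t| ^+ 2 + beta x}) :
  exists u : R * R -> R,
    is_solution p V a f u /\
    (forall v, H01 p V v -> (functional p V a f u <= functional p V a f v)%E).
Proof.
have a_bnd x : vertices p x -> inf (a @` vertices p) <= a x <= sup (a @` vertices p).
  move=> px; apply/andP; split.
    apply: ge_inf; last by exists x.
    by exists 0 => _ [y /ha_pos/ltW ? <-].
  by apply: ub_le_sup => //; exists x.
have [u Hu minu] := J_minimizer hV ha_inf a_bnd hf halpha hbeta hF.
exists u; split; first exact: (minimizer_is_solution hV ha_inf a_bnd hf Hu minu).
move=> v Hv; rewrite (functionalE hV ha_inf a_bnd hf Hu).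
by rewrite (functionalE hV ha_inf a_bnd hf Hv) lee_fin; exact: minu.
Qed.
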